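(* Let $\alpha\in(1,2)$, $\sigma>0$, and assume the Standing Assumption. Let $\mu_0$ be a probability measure on $\mathbb{R}^p$ with finite first moment. For $n\ge1$ and $\eta>0$, let $\hat\theta^{i,n}_0$, $i\le n$, be i.i.d. with law $\mu_0$, let $X^{i,n}_k$ ($i\le n$, $k\ge0$) be i.i.d. copies of $\mathrm{L}_1$ for an $\alpha$-stable Lévy process $\mathrm{L}$ of Type-I, II or III, independent of the initialization, and define \[ \hat\theta^{i,n}_{k+1}=\hat\theta^{i,n}_k-\eta n\,\partial_{\theta^{i,n}}R(\hat\Theta^n_k)+\sigma\eta^{1/\alpha}X^{i,n}_k, \] where $\hat\Theta^n_k\in\mathbb{R}^{p\times n}$ has columns $\hat\theta^{1,n}_k,\dots,\hat\theta^{n,n}_k$. For $\kappa\in(0,1)$, let $\hat\Theta^{(\kappa n)}_k$ be obtained from $\hat\Theta^n_k$ by keeping the $\lfloor\kappa n\rfloor$ columns with largest Euclidean norms and setting all other columns to zero. Then for every $t>0$, $\kappa\in(0,1)$ and every sufficiently small $\epsilon>0$ there exists $N\in\mathbb{N}$ such that for all $n\ge N$ and all $\eta\le n^{-\alpha/2-1}$, with probability at least $1-\epsilon$, \[ \frac{\big\|\hat\Theta^{(\kappa n)}_{\lfloor t/\eta\rfloor}-\hat\Theta^n_{\lfloor t/\eta\rfloor}\big\|_F}{\big\|\hat\Theta^n_{\lfloor t/\eta\rfloor}\big\|_F}\le\epsilon. \]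
   Context: Data distribution $\pi$ on $\mathcal{X}\times\mathcal{Y}$, $\mathcal{X}\subset\mathbb{R}^d$; models $h_x:\mathbb{R}^p\to\mathbb{R}^l$; loss $\ell:\mathbb{R}^l\times\mathcal{Y}\to\mathbb{R}_+$. The mean-field network with parameters $\Theta^n=(\theta^{1,n},\dots,\theta^{n,n})\in\mathbb{R}^{p\times n}$ is $f_{\Theta^n}(x)=\frac1n\sum_{i=1}^nh_x(\theta^{i,n})$, and the risk is $R(\Theta^n)=\mathbb{E}_{(x,y)\sim\pi}[\ell(f_{\Theta^n}(x),y)]$. $\|\cdot\|_F$ is the Frobenius norm. Standing Assumption: each $h_x$ is twice differentiable with $\|h_x\|_\infty+\|\nabla h_x\|_\infty+\|\nabla^2h_x\|_\infty\le\Psi(x)$; $\|\partial_1\ell(\cdot,y)\|_\infty+\|\partial_1^2\ell(\cdot,y)\|_\infty\le\Phi(y)$ (derivatives in the first argument); and $\mathbb{E}_{\pi}[\Psi(x)^2(1+\Phi(y)^2)]\le B^2$ for some $B>0$. An $\alpha$-stable Lévy process $(\mathrm{L}_t)$ in $\mathbb{R}^p$ is a stochastically continuous process with $\mathrm{L}_0=0$, independent increments, and $\mathrm{L}_t-\mathrm{L}_s\overset{d}{=}(t-s)^{1/\alpha}\mathrm{L}_1$; Type-I: $\mathrm{L}_1=\mathbf{1}_pZ$ with $Z$ real symmetric $\alpha$-stable ($\mathbb{E}e^{i\omega Z}=e^{-|\omega|^\alpha}$); Type-II: $\mathrm{L}_1$ has i.i.d. such coordinates; Type-III: $\mathbb{E}e^{i\langle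 u,\mathrm{L}_1\rangle}=e^{-\|u\|^\alpha}$. *)

(* Defs.v *)
From HB Require Import structures.
From mathcomp Require Import all_boot all_order all_algebra.
From mathcomp Require Import all_classical all_reals all_analysis.
Set Implicit Arguments. Unset Strict Implicit. Unset Printing Implicit Defensive.
Import Order.TTheory GRing.Theory Num.Theory.
Import numFieldNormedType.Exports.
Local Open Scope classical_set_scope.
Local Open Scope ring_scope.

Notation Rvec R p := (g_sigma_algebraType (@open (matrix (Real.sort R) p 1))).

Section Defs.
Variable R : realType.

Definition enorm (p : nat) (v : 'cV[R]_p) : R := Num.sqrt (\sum_(j < p) v j 0 ^+ 2).
Definition dotv (p : nat) (u v : 'cV[R]_p) : R := \sum_(j < p) u j 0 * v j 0.
Definition frob (p n : nat) (M : 'M[R]_(p, n)) : R :=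
  Num.sqrt (\sum_(j < p) \sum_(i < n) M j i ^+ 2).

Definition evec (p : nat) (j : 'I_p) : 'cV[R]_p := delta_mx j 0.

Definition has_law d d' (O : measurableType d) (T : measurableType d')
  (P : probability O R) (Xr : O -> T) (mu : set T -> \bar R) :=
  forall A : set T, measurable A -> P (Xr @^-1` A) = mu A.

Definition mutually_independent d d' (O : measurableType d) (T : measurableType d')
  (I : eqType) (P : probability O R) (f : I -> O -> T) :=
  forall (s : seq I) (A : I -> set T), uniq s -> (forall i, measurable (A i)) ->
    P (\bigcap_(i in [set i | i \in s]) (f i @^-1` A i)) =
    (\prod_(i <- s) P (f i @^-1` A i))%E.

(* standard real symmetric alpha-stable law: E e^{i w Z} = e^{-|w|^alpha}
   (real and imaginary parts) *)
Definition SaS_law (alpha : R) (zeta : probability R R) :=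
  forall w : R, Rintegral zeta setT (fun z => cos (w * z)) = expR (- `|w| `^ alpha)
              /\ Rintegral zeta setT (fun z => sin (w * z)) = 0.

Definition stable_typeI (p : nat) (alpha : R) (nu : probability (Rvec R p) R) :=
  exists zeta : probability R R, SaS_law alpha zeta /\
    forall A : set (Rvec R p), measurable A ->
      nu A = zeta ((fun z : R => (const_mx z : 'cV[R]_p)) @^-1` A).

Definition stable_typeII (p : nat) (alpha : R) (nu : probability (Rvec R p) R) :=
  exists zeta : probability R R, SaS_law alpha zeta /\
    forall A : 'I_p -> set R, (forall j, measurable (A j)) ->
      nu [set x : Rvec R p | forall j, A j (x j 0)] = (\prod_(j < p) zeta (A j))%E.

Definition stable_typeIII (p : nat) (alpha : R) (nu : probability (Rvec R p) R) :=
  forall u : 'cV[R]_p,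
    Rintegral nu setT (fun x : Rvec R p => cos (dotv u x)) = expR (- enorm u `^ alpha)
 /\ Rintegral nu setT (fun x : Rvec R p => sin (dotv u x)) = 0.

Definition stable_L1 (p : nat) (alpha : R) (nu : probability (Rvec R p) R) :=
  stable_typeI alpha nu \/ stable_typeII alpha nu \/ stable_typeIII alpha nu.

Definition twice_diff (p l : nat) (f : 'cV[R]_p -> 'cV[R]_l) :=
  (forall th, differentiable f th) /\
  (forall (j : 'I_p) th, differentiable ('D_(evec j) f) th).

Definition twice_diff_real (l : nat) (f : 'cV[R]_l -> R) :=
  (forall a, differentiable f a) /\
  (forall (j : 'I_l) a, differentiable ('D_(evec j) f) a).

Definition fnet dX (X : measurableType dX) (p l n : nat)
  (h : X -> 'cV[R]_p -> 'cV[R]_l) (Th : 'M[R]_(p, n)) (x : X) : 'cV[R]_l :=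
  n%:R^-1 *: \sum_(i < n) h x (col i Th).

Definition risk dX dY (X : measurableType dX) (Y : measurableType dY) (p l n : nat)
  (pi : probability (X * Y)%type R) (h : X -> 'cV[R]_p -> 'cV[R]_l)
  (ell : 'cV[R]_l -> Y -> R) (Th : 'M[R]_(p, n)) : R :=
  fine (\int[pi]_z (ell (fnet h Th z.1) z.2)%:E)%E.

Definition gradR dX dY (X : measurableType dX) (Y : measurableType dY) (p l n : nat)
  (pi : probability (X * Y)%type R) (h : X -> 'cV[R]_p -> 'cV[R]_l)
  (ell : 'cV[R]_l -> Y -> R) (Th : 'M[R]_(p, n)) : 'M[R]_(p, n) :=
  \matrix_(j < p, i < n)
     'D_(delta_mx j i : 'M[R]_(p, n)) (@risk _ _ X Y p l n pi h ell) Th.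

Fixpoint sgd_traj dX dY (X : measurableType dX) (Y : measurableType dY) (p l n : nat)
  (pi : probability (X * Y)%type R) (h : X -> 'cV[R]_p -> 'cV[R]_l)
  (ell : 'cV[R]_l -> Y -> R) (alpha sigma eta : R)
  (Th0 : 'M[R]_(p, n)) (Xk : nat -> 'M[R]_(p, n)) (k : nat) : 'M[R]_(p, n) :=
  match k with
  | 0%N => Th0
  | k'.+1 =>
      let T := sgd_traj pi h ell alpha sigma eta Th0 Xk k' in
      T - (eta * n%:R) *: gradR pi h ell T + (sigma * eta `^ alpha^-1) *: Xk k'
  end.

Definition is_top_cols (p n : nat) (Th : 'M[R]_(p, n)) (S : {set 'I_n}) (m : nat) :=
  #|S| = m /\ forall i j : 'I_n, i \in S -> j \notin S ->
                enorm (col j Th) <= enorm (col i Th).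

Definition keep_cols (p n : nat) (Th : 'M[R]_(p, n)) (S : {set 'I_n}) : 'M[R]_(p, n) :=
  \matrix_(j < p, i < n) (if i \in S then Th j i else 0).

End Defs.

(* Main.v *)
Require Import Defs.
From HB Require Import structures.
From mathcomp Require Import all_boot all_order all_algebra.
From mathcomp Require Import all_classical all_reals all_analysis.
From mathcomp Require Import measurable_realfun ring lra.
Set Implicit Arguments. Unset Strict Implicit. Unset Printing Implicit Defensive.
Import Order.TTheory GRing.Theory Num.Theory.
Import numFieldNormedType.Exports.
Local Open Scope classical_set_scope.
Local Open Scope ring_scope.

(** The risk is Lipschitz in each column with constant O(1/n), so the drift moves
    every column by at most a constant C over time t.  Up to this bounded error a
    column is theta0 + W with W = sigma eta^(1/alpha) (X_0 + ... + X_{K-1}), whose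
    characteristic function is exp(-K eta sigma^alpha |v|^alpha) in each coordinate.
    - Near v = 0 this gives tightness of the columns uniformly in eta, so (Markov)
      with high probability at most kappa n columns have norm above some M; the
      discarded columns then contribute at most n M^2 to the squared norm.
    - Since 1 - cos x <= x^2, the squared norm of all the columns is at least
      v^-2 times the sum of 1 - cos(v Y_i), an i.i.d. bounded sum of mean at least
      1 - exp(-c v^alpha), and (1 - exp(-c v^alpha)) / v^2 is unbounded as v -> 0
      because alpha < 2.  By Chebyshev the total squared norm exceeds n L for any L. *)

(** * Lipschitz bounds from directional derivatives *)

(* When the limit defining ['D_v f a] does not exist, its junk value is [0], so
   no differentiability is needed. *)
Lemma normr_derive_le (R : realType) (V : normedModType R) (f : V -> R)
    (a v : V) (C : R) :
  0 <= C -> (forall s, `|f (s *: v + a) - f a| <= C * `|s|) ->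
  `|'D_v f a| <= C.
Proof.
move=> C0 fC; rewrite /derive; set F := (X in lim X).
have [cF|dF] := pselect (cvg F); last first.
  by rewrite (dvgP dF) (_ : point = 0) ?normr0.
have Fle : \forall s \near 0^', `|s^-1 *: ((f \o shift a) (s *: v) - f a)| <= C.
  near=> s; have s0 : s != 0 by near: s; exact: nbhs_dnbhs_neq.
  rewrite /= normrZ normfV mulrC ler_pdivrMr ?normr_gt0//.
rewrite ler_norml; apply/andP; split.
  by apply: limr_ge => //; apply: filterS Fle => s; rewrite ler_norml => /andP[].
by apply: limr_le => //; apply: filterS Fle => s; rewrite ler_norml => /andP[].
Unshelve. all: by end_near. Qed.

(** The one-variable mean value theorem on [0, 1] for [s |-> f (a + s *: v)], whose derivative the
    chain rule identifies. *)
Lemma derive_mean_value (R : realType) (V : normedModType R) (f : V -> R)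
    (a v : V) :
  (forall x, differentiable f x) ->
  exists x, f (a + v) - f a = 'D_v f x.
Proof.
move=> df; pose g (s : R) := f (a + s *: v).
have dg (s : R) : is_derive s 1 g ('D_v f (a + s *: v)).
  have dl : is_diff s (fun s : R => a + s *: v) (fun s => s *: v).
    rewrite (_ : (fun s => s *: v) = 0 + ( *:%R^~ v)); last first.
      by apply/funext => x; rewrite fctE add0r.
    exact: is_diffD.
  have dfs := differentiableP (df (a + s *: v)).
  have dgs : differentiable g s.
    by have := @differentiable_comp _ _ _ _ (fun s : R => a + s *: v) f s; apply.
  apply: DeriveDef; first exact: diff_derivable.
  rewrite deriveE// (@diff_comp _ _ _ _ (fun s : R => a + s *: v) f)//=.
  by rewrite [X in 'd f _ (X _)]diff_val scale1r deriveE.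
have cg : {within `[0, 1], continuous g}.
  apply: continuous_subspaceT => s; apply/differentiable_continuous.
  by apply/derivable1_diffP; exact: ex_derive.
have [c _] := MVT_segment ler01 (fun x _ => dg x) cg.
rewrite subr0 mulr1 /g scale1r scale0r addr0 => ->.
by exists (a + c *: v).
Qed.

Lemma cV_delta_sum (R : realType) (l : nat) (v : 'cV[R]_l) :
  v = \sum_(j < l) v j 0 *: evec R j.
Proof.
apply/matrixP => i k; rewrite ord1 summxE (bigD1 i)//= !mxE !eqxx mulr1.
by rewrite big1 ?addr0// => j ji; rewrite !mxE eq_sym (negbTE ji) mulr0.
Qed.

Lemma mx_norm_leP (R : realType) (m n : nat) (v : 'M[R]_(m, n)) (C : R) :
  0 <= C -> (forall i j, `|v i j| <= C) -> `|v| <= C.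
Proof.
move=> C0 vC; rewrite /Num.norm/= mx_normrE; apply/bigmax_leP; split => // -[i j] _; exact: vC.
Qed.

Lemma le_mx_norm (R : realType) (m n : nat) (v : 'M[R]_(m, n)) i j : `|v i j| <= `|v|.
Proof.
by rewrite [leRHS]/Num.norm/= mx_normrE; apply/bigmax_geP; right; exists (i, j).
Qed.

(** The norm on matrices is the sup norm, so it pairs with the l^1 norm of the partial derivatives,
    which is the quantity bounded by [Phi]. *)
Lemma lipschitz_partial (R : realType) (l : nat) (f : 'cV[R]_l -> R) (K : R) (a b : 'cV[R]_l) :
  (forall x, differentiable f x) ->
  (forall x, \sum_(j < l) `|'D_(evec R j) f x| <= K) ->
  `|f b - f a| <= K * `|b - a|.
Proof.
move=> df fK; have [x] := derive_mean_value a (b - a) df.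
rewrite addrCA subrr addr0 => ->.
rewrite deriveE// [X in 'd f x X]cV_delta_sum linear_sum/=.
apply: le_trans (ler_norm_sum _ _ _) _.
apply: (@le_trans _ _ (\sum_(j < l) `|'D_(evec R j) f x| * `|b - a|)).
  apply: ler_sum => j _; rewrite linearZ/= -deriveE// normrM mulrC ler_wpM2l//.
  exact: le_mx_norm.
by rewrite -mulr_suml ler_wpM2r.
Qed.

(** Named so that it can carry a linear structure, from which its differential is read off. *)
Definition cV_coord (R : realType) (l : nat) (i : 'I_l) (M : 'cV[R]_l) : R := M i 0.

Lemma cV_coord_linear (R : realType) (l : nat) (i : 'I_l) : linear (@cV_coord R l i).
Proof. by move=> k u v; rewrite /cV_coord !mxE. Qed.

HB.instance Definition _ (R : realType) (l : nat) (i : 'I_l) :=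
  GRing.isLinear.Build R 'cV[R]_l R *:%R (@cV_coord R l i) (@cV_coord_linear R l i).

(** The mean value theorem fails for vector values, but it may be applied to each coordinate with
    its own intermediate point; the sup norm then loses nothing. *)
Lemma lipschitz_derive_cV (R : realType) (p l : nat) (h : 'cV[R]_p -> 'cV[R]_l)
    (K s : R) (v a : 'cV[R]_p) :
  (forall x, differentiable h x) -> 0 <= K ->
  (forall x, `|'D_v h x| <= K) ->
  `|h (a + s *: v) - h a| <= K * `|s|.
Proof.
move=> dh K0 hK; apply: mx_norm_leP; first exact: mulr_ge0.
move=> i j; rewrite ord1 !mxE.
have dc x : is_diff x (fun x => h x i 0) (fun u => 'd h x u i 0).
  have dcoord y : is_diff y (@cV_coord R l i) (@cV_coord R l i).
    have cc : continuous (@cV_coord R l i) by exact: coord_continuous.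
    by apply: DiffDef; [exact: linear_differentiable|exact: diff_lin].
  exact: (is_diff_comp (differentiableP (dh x)) (dcoord (h x))).
have dcx x : differentiable (fun x => h x i 0) x by have [] := dc x.
have [x ->] := derive_mean_value a (s *: v) dcx.
rewrite deriveE// (@diff_val _ _ _ _ _ _ _ (dc x)) linearZ/= mxE normrM mulrC ler_wpM2r//.
by rewrite -deriveE//; apply: le_trans (hK x); exact: le_mx_norm.
Qed.

(** * The O(1/n) bound on the entries of the risk gradient *)

Section gradient_bound.
Variables (R : realType) (p l n : nat) (dX dY : measure_display).
Variables (X : measurableType dX) (Y : measurableType dY).
Variables (pi : probability (X * Y)%type R).
Variables (h : X -> 'cV[R]_p -> 'cV[R]_l) (ell : 'cV[R]_l -> Y -> R).
Variables (Psi : X -> R) (Phi : Y -> R) (B : R).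
Hypothesis dh : forall x, twice_diff (h x).
Hypothesis hPsi : forall x th, `|h x th| + \sum_(j < p) `|'D_(evec R j) (h x) th|
  + \sum_(j < p) \sum_(k < p) `|'D_(evec R k) ('D_(evec R j) (h x)) th| <= Psi x.
Hypothesis dell : forall y, twice_diff_real (ell^~ y).
Hypothesis ellPhi : forall a y, \sum_(j < l) `|'D_(evec R j) (ell^~ y) a|
  + \sum_(j < l) \sum_(k < l) `|'D_(evec R k) ('D_(evec R j) (ell^~ y)) a| <= Phi y.
Hypothesis mPsi : measurable_fun setT Psi.
Hypothesis mPhi : measurable_fun setT Phi.
Hypothesis momB : (\int[pi]_z ((Psi z.1) ^+ 2 * (1 + (Phi z.2) ^+ 2))%:E <= (B ^+ 2)%:E)%E.
Hypothesis iell : forall (Th : 'M[R]_(p, n)),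
  pi.-integrable setT (fun z => (ell (fnet h Th z.1) z.2)%:E).

Lemma Psi_ge0 x : 0 <= Psi x.
Proof.
apply: le_trans (hPsi x 0); rewrite !addr_ge0//; do ?apply: sumr_ge0 => *; rewrite ?sumr_ge0//.
Qed.

Lemma Phi_ge0 y : 0 <= Phi y.
Proof.
apply: le_trans (ellPhi 0 y); rewrite !addr_ge0//; do ?apply: sumr_ge0 => *; rewrite ?sumr_ge0//.
Qed.

Lemma model_lipschitz x (j : 'I_p) (s : R) a :
  `|h x (a + s *: evec R j) - h x a| <= Psi x * `|s|.
Proof.
apply: lipschitz_derive_cV; [exact: (dh x).1|exact: Psi_ge0|move=> th].
apply: le_trans (hPsi x th); rewrite (bigD1 j)//=.
rewrite -!addrA addrCA lerDl.
rewrite !addr_ge0//; do ?apply: sumr_ge0 => *; rewrite ?sumr_ge0//.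
Qed.

Lemma loss_lipschitz y a b : `|ell b y - ell a y| <= Phi y * `|b - a|.
Proof.
apply: (lipschitz_partial (f := ell^~ y)); first exact: (dell y).1.
move=> x; apply: le_trans (ellPhi x y); rewrite lerDl.
by do ?apply: sumr_ge0 => *; rewrite ?sumr_ge0.
Qed.

(** Moving one entry changes one column, hence one of the n averaged terms: this is the source of
    the factor 1/n. *)
Lemma fnet_lipschitz x (Th : 'M[R]_(p, n)) (j : 'I_p) (i : 'I_n) (s : R) :
  `|fnet h (s *: delta_mx j i + Th) x - fnet h Th x| <= n%:R^-1 * (Psi x * `|s|).
Proof.
rewrite /fnet -scalerBr normrZ ger0_norm ?invr_ge0// ler_wpM2l ?invr_ge0//.
rewrite (bigD1 i)//= [X in _ - X](bigD1 i)//= opprD addrACA.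
rewrite [X in _ + X](_ : _ = 0); last first.
  apply/eqP; rewrite subr_eq0; apply/eqP; apply: eq_bigr => k ki; congr (h x _).
  by apply/matrixP => a b; rewrite !mxE (negbTE ki) andbF mulr0 add0r.
rewrite addr0 (_ : col i _ = col i Th + s *: evec R j); first exact: model_lipschitz.
by apply/matrixP => a b; rewrite !mxE ord1 !eqxx !andbT addrC.
Qed.

(** The integrand moves by at most [Phi * Psi * |s| / n], and [Psi * Phi <= 1 + Psi^2 (1 + Phi^2)],
    whose integral the moment assumption bounds by [1 + B^2]. *)
Lemma risk_lipschitz (Th : 'M[R]_(p, n)) (j : 'I_p) (i : 'I_n) (s : R) :
  `|risk pi h ell (s *: delta_mx j i + Th) - risk pi h ell Th|
    <= n%:R^-1 * (1 + B ^+ 2) * `|s|.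
Proof.
set Th' := _ + Th.
have i1 := iell Th'; have i2 := iell Th.
rewrite /risk -fineB; try exact: integrable_fin_num.
rewrite -integralB// -lee_fin; set I := (\int[pi]_z _)%E.
have fI : I \is a fin_num.
  by rewrite /I integralB// fin_numB; apply/andP; split; exact: integrable_fin_num.
rewrite -fine_abse// fineK ?abse_fin_num//.
have mD := measurable_int pi (integrableB measurableT i1 i2).
have mw : measurable_fun setT (fun z : X * Y => Psi z.1 ^+ 2 * (1 + Phi z.2 ^+ 2)).
  apply: measurable_funM; first by apply: measurable_funX; exact: measurableT_comp.
  by apply: measurable_funD => //; apply: measurable_funX; exact: measurableT_comp.
have w0 z : 0 <= Psi z.1 ^+ 2 * (1 + Phi z.2 ^+ 2) :> R.
  by rewrite mulr_ge0 ?addr_ge0 ?sqr_ge0.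
apply: le_trans (le_abse_integral _ _ _) _ => //.
set c := n%:R^-1 * `|s|.
have c0 : 0 <= c by rewrite mulr_ge0 ?invr_ge0.
apply: (@le_trans _ _ (\int[pi]_z (c%:E * (1 + (Psi z.1 ^+ 2 * (1 + Phi z.2 ^+ 2))%:E)))%E).
  apply: ge0_le_integral => //.
  - exact: measurableT_comp mD.
  - apply/measurable_EFinP; apply: measurable_funM => //; exact: measurable_funD.
  - move=> z _ /=; rewrite lee_fin.
    apply: le_trans (loss_lipschitz _ _ _) _.
    apply: (@le_trans _ _ (Phi z.2 * (n%:R^-1 * (Psi z.1 * `|s|)))).
      by rewrite ler_wpM2l ?Phi_ge0// fnet_lipschitz.
    rewrite (_ : _ * _ = c * (Psi z.1 * Phi z.2)); last by rewrite /c; ring.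
    rewrite ler_wpM2l//; have := Psi_ge0 z.1; have := Phi_ge0 z.2.
    move: (Psi z.1) (Phi z.2) => u v; nra.
rewrite ge0_integralZl//; last 2 first.
- by apply/measurable_EFinP; exact: measurable_funD.
- by move=> z _; rewrite -EFinD lee_fin addr_ge0.
rewrite ge0_integralD//; last 2 first.
- by move=> z _; rewrite lee_fin.
- exact/measurable_EFinP.
have -> : (\int[pi]__ 1 = 1)%E.
  rewrite (@integral_cst _ _ _ pi setT measurableT 1) mul1e; exact: (@probability_setT _ _ _ pi).
rewrite (_ : _ * _ * `|s| = c * (1 + B ^+ 2)); last by rewrite /c; ring.
rewrite [(c * _)%:E]EFinM; apply: lee_pmul; rewrite ?lee_fin//.
  by apply: adde_ge0 => //; apply: integral_ge0 => z _; rewrite lee_fin.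
by rewrite EFinD; exact: leeD2l.
Qed.

Lemma gradR_bound (Th : 'M[R]_(p, n)) j i :
  `|gradR pi h ell Th j i| <= n%:R^-1 * (1 + B ^+ 2).
Proof.
rewrite mxE; apply: normr_derive_le.
  by rewrite mulr_ge0 ?invr_ge0// addr_ge0// sqr_ge0.
by move=> s; exact: risk_lipschitz.
Qed.

End gradient_bound.

(** * Bounded measurable functions and their expectations *)

Section bounded_measurable.
Context {d : measure_display} {T : measurableType d} {R : realType}.
Implicit Types (f g : T -> R).

(** A class closed under sums and products and integrable for every probability, so that
    expectations can be rearranged freely. *)
Definition bmf f := measurable_fun setT f /\ exists M, forall x, `|f x| <= M.

Lemma bmf_cst (c : R) : bmf (fun=> c).
Proof. by split; [exact: measurable_cst|exists `|c|]. Qed.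

Lemma bmfD f g : bmf f -> bmf g -> bmf (fun x => f x + g x).
Proof.
move=> [mf [M fM]] [mg [N gN]]; split; first exact: measurable_funD.
by exists (M + N) => x; apply: le_trans (ler_normD _ _) _; exact: lerD.
Qed.

Lemma bmfM f g : bmf f -> bmf g -> bmf (fun x => f x * g x).
Proof.
move=> [mf [M fM]] [mg [N gN]]; split; first exact: measurable_funM.
by exists (M * N) => x; rewrite normrM ler_pM.
Qed.

Lemma bmfZ (a : R) f : bmf f -> bmf (fun x => a * f x).
Proof. exact/bmfM/bmf_cst. Qed.

Lemma bmfB f g : bmf f -> bmf g -> bmf (fun x => f x - g x).
Proof.
move=> bf bg; rewrite (_ : (fun x => _) = (fun x => f x + (-1) * g x)).
  by apply: bmfD => //; exact: bmfZ.
by apply/funext => x; rewrite mulN1r.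
Qed.

Lemma bmf_indic (A : set T) : measurable A -> bmf (\1_A : T -> R).
Proof.
move=> mA; split; first exact: measurable_indic.
by exists 1 => x; rewrite indicE; case: (_ \in _); rewrite ?normr1 ?normr0.
Qed.

Lemma bmf_sum (I : Type) (s : seq I) (h : I -> T -> R) :
  (forall i, bmf (h i)) -> bmf (fun x => \sum_(i <- s) h i x).
Proof.
move=> bh; elim: s => [|i s ih].
  by under eq_fun do rewrite big_nil; exact: bmf_cst.
by under eq_fun do rewrite big_cons; exact: bmfD.
Qed.

Lemma bmf_prod (I : Type) (s : seq I) (h : I -> T -> R) :
  (forall i, bmf (h i)) -> bmf (fun x => \prod_(i <- s) h i x).
Proof.
move=> bh; elim: s => [|i s ih].
  by under eq_fun do rewrite big_nil; exact: bmf_cst.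
by under eq_fun do rewrite big_cons; exact: bmfM.
Qed.

Lemma bmf_cos f : measurable_fun setT f -> bmf (fun x => cos (f x)).
Proof.
move=> mf; split; last by exists 1 => x; exact: cos_max.
by apply: (measurableT_comp _ mf); apply: continuous_measurable_fun; exact: continuous_cos.
Qed.

Lemma bmf_sin f : measurable_fun setT f -> bmf (fun x => sin (f x)).
Proof.
move=> mf; split; last by exists 1 => x; exact: sin_max.
by apply: (measurableT_comp _ mf); apply: continuous_measurable_fun; exact: continuous_sin.
Qed.

End bounded_measurable.

Lemma bmf_comp d1 d2 (T1 : measurableType d1) (T2 : measurableType d2) (R : realType)
    (f : T2 -> R) (X : T1 -> T2) :
  bmf f -> measurable_fun setT X -> bmf (fun w => f (X w)).
Proof.
by move=> [mf [M fM]] mX; split; [exact: measurableT_comp|exists M].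
Qed.

Section expectation.
Context {d : measure_display} {T : measurableType d} {R : realType}.
Variable P : probability T R.
Implicit Types (f g : T -> R).
Local Notation Ex f := (Rintegral P setT f).

Lemma bmf_integrable f : bmf f -> P.-integrable setT (EFin \o f).
Proof.
move=> [mf [M fM]]; have PT : (P setT < +oo)%E by rewrite probability_setT ltry.
apply: measurable_bounded_integrable => //; exists M; split; first exact: num_real.
by move=> N MN x _ /=; exact: le_trans (fM x) (ltW MN).
Qed.

Lemma ExD f g : bmf f -> bmf g -> Ex (fun x => f x + g x) = Ex f + Ex g.
Proof. by move=> bf bg; apply: RintegralD => //; exact: bmf_integrable. Qed.

Lemma ExZ (a : R) f : bmf f -> Ex (fun x => a * f x) = a * Ex f.
Proof. by move=> bf; apply: RintegralZl => //; exact: bmf_integrable. Qed.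

Lemma ExB f g : bmf f -> bmf g -> Ex (fun x => f x - g x) = Ex f - Ex g.
Proof. by move=> bf bg; apply: RintegralB => //; exact: bmf_integrable. Qed.

Lemma Ex_cst (a : R) : Ex (fun=> a) = a.
Proof. have PT : P setT = 1%E := probability_setT P.
rewrite Rintegral_cst// -[RHS]mulr1; congr *%R; exact: (congr1 fine PT). Qed.

Lemma Ex_le f g : bmf f -> bmf g -> (forall x, f x <= g x) -> Ex f <= Ex g.
Proof. by move=> bf bg fg; apply: le_Rintegral => //; exact: bmf_integrable. Qed.

Lemma Ex_sum (I : Type) (s : seq I) (h : I -> T -> R) : (forall i, bmf (h i)) ->
  Ex (fun x => \sum_(i <- s) h i x) = \sum_(i <- s) Ex (h i).
Proof.
move=> bh; elim: s => [|i s ih].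
  by under eq_fun do rewrite big_nil; rewrite Ex_cst big_nil.
under eq_fun do rewrite big_cons.
by rewrite ExD// ?ih ?big_cons//; exact: bmf_sum.
Qed.

Lemma Ex_indic (A : set T) : measurable A -> Ex (\1_A) = fine (P A).
Proof. by move=> mA; rewrite /Rintegral integral_indic// setIT. Qed.

Lemma Ex_norm_le f (C : R) : bmf f -> (forall x, `|f x| <= C) -> `|Ex f| <= C.
Proof.
move=> bf fC; rewrite ler_norml; apply/andP; split.
  rewrite -(Ex_cst (- C)); apply: Ex_le => //; first exact: bmf_cst.
  by move=> x; have := fC x; rewrite ler_norml => /andP[].
rewrite -[leRHS](Ex_cst C); apply: Ex_le => //; first exact: bmf_cst.
by move=> x; have := fC x; rewrite ler_norml => /andP[].
Qed.

End expectation.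

(** * Extending identities from indicators to bounded measurable functions *)

Lemma staircase_approx (R : realType) (N : nat) (y : R) : 0 <= y <= N%:R ->
  `|y - \sum_(k < N) (k.+1%:R <= y)%R%:R| <= 1.
Proof.
elim: N => [|N ih] /andP[y0 yN].
  by rewrite big_ord0 subr0 ger0_norm//; apply: le_trans yN _.
rewrite big_ord_recr/=; have [yN'|Ny] := leP y N%:R.
  rewrite [in X in _ + X]leNgt (le_lt_trans yN') ?ltr_nat//= addr0.
  by apply: ih; rewrite y0.
have -> : \sum_(k < N) (k.+1%:R <= y)%R%:R = N%:R :> R.
  rewrite (eq_bigr (fun=> 1)) ?sumr_const ?card_ord// => k _.
  by rewrite (le_trans _ (ltW Ny)) ?ler_nat.
by case: (leP N.+1%:R y) yN => /= yN1; rewrite -natr1 in yN1 *;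
  rewrite ler_norml => yN; apply/andP; split; lra.
Qed.

Section bounded_functional.
Context {d : measure_display} {T : measurableType d} {R : realType}.

(** Shift and rescale the range of f to [0, N]; the sum of indicators of superlevel sets is then the
    integer part, which is off by at most one unit, that is by e. *)
Lemma bmf_simple_approx (f : T -> R) (e : R) : bmf f -> 0 < e ->
  exists (N : nat) (b : R) (A : nat -> set T), (forall k, measurable (A k)) /\
    forall x, `|f x - (b + e * \sum_(k < N) \1_(A k) x)| <= e.
Proof.
move=> [mf [M fM]] e0; pose N := (Num.truncn (2 * M / e)).+1.
exists N, (- M), (fun k => [set x | - M + e * k.+1%:R <= f x]); split.
  move=> k; rewrite -[X in measurable X]setTI.
  rewrite (_ : [set x | _] = f @^-1` `[(- M + e * k.+1%:R), +oo[%classic).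
    by apply: mf => //; exact: measurable_itv.
  by apply/seteqP; split => x /=; rewrite in_itv/= andbT.
move=> x; set y := (f x + M) / e.
have fE : f x = - M + e * y by rewrite /y mulrC divfK ?gt_eqF//; ring.
have := fM x; rewrite ler_norml => /andP[fl fu].
have yN : 0 <= y <= N%:R.
  apply/andP; split; first by rewrite /y divr_ge0 ?(ltW e0)//; lra.
  apply: (@le_trans _ _ (2 * M / e)); last first.
    by apply: ltW; rewrite /N; apply: truncnS_gt.
  by rewrite /y ler_pM2r ?invr_gt0//; lra.
rewrite (eq_bigr (fun k : 'I_N => (k.+1%:R <= y)%R%:R)); last first.
  move=> k _; rewrite indicE; congr (_%:R); congr (nat_of_bool _).
  apply/idP/idP; rewrite inE/= fE lerD2l ler_pM2l//.
rewrite {1}fE (_ : _ - _ = e * (y - \sum_(k < N) (k.+1%:R <= y)%R%:R)); last by ring.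
rewrite normrM gtr0_norm// -[leRHS]mulr1 ler_pM2l//; exact: staircase_approx.
Qed.

(** By linearity L vanishes on simple functions, which are uniformly dense, and the sup-norm bound
    passes to the limit. It is meant for differences of two expectations known to agree on
    indicators. *)
Lemma bmf_functional_eq0 (L : (T -> R) -> R) (C : R) :
  (forall f g, bmf f -> bmf g -> L (fun x => f x + g x) = L f + L g) ->
  (forall a f, bmf f -> L (fun x => a * f x) = a * L f) ->
  (forall f e, bmf f -> (forall x, `|f x| <= e) -> `|L f| <= C * e) ->
  (forall A, measurable A -> L (\1_A) = 0) ->
  forall f, bmf f -> L f = 0.
Proof.
move=> LD LZ Lb L1 f bf; apply/eqP; rewrite -normr_le0; apply/ler_addgt0Pl => e e0.
(* Adding 1 to [|C|] keeps the divisor positive for every C, while still [C * e' <= e]. *)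
rewrite addr0; pose e' := e / (`|C| + 1).
have C1 : 0 < `|C| + 1 by rewrite ltr_wpDl.
have e'0 : 0 < e' by rewrite divr_gt0.
have [N [b [A [mA fA]]]] := bmf_simple_approx bf e'0.
pose S x : R := \sum_(k < N) \1_(A k) x.
have bS : bmf S by apply: bmf_sum => k; exact: bmf_indic.
have LS : L S = 0.
  suff H m : L (fun x => \sum_(0 <= k < m) (\1_(A k) x : R)) = 0.
    by rewrite -[RHS](H N); congr L; apply/funext => x; rewrite big_mkord.
  elim: m => [|m ih].
    rewrite (_ : (fun x => _) = (fun x => 0 * S x)) ?LZ ?mul0r//.
    by apply/funext => x; rewrite big_geq// mul0r.
  rewrite (_ : (fun x => _) = (fun x => \sum_(0 <= k < m) \1_(A k) x + \1_(A m) x)).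
    rewrite LD ?ih ?L1 ?addr0//; last exact: bmf_indic.
    by apply: bmf_sum => k; exact: bmf_indic.
  by apply/funext => x; rewrite big_nat_recr.
have b1 : bmf (fun x : T => b * \1_setT x : R) by apply/bmfZ/bmf_indic.
have bg : bmf (fun x => b * \1_setT x + e' * S x : R) by apply: bmfD => //; exact: bmfZ.
have Lg : L (fun x => b * \1_setT x + e' * S x : R) = 0.
  by rewrite LD ?LZ ?L1 ?LS ?mulr0 ?addr0//; [exact: bmf_indic|exact: bmfZ].
have -> : f = (fun x => (f x - (b * \1_setT x + e' * S x)) + (b * \1_setT x + e' * S x)).
  by apply/funext => x; rewrite subrK.
rewrite LD// ?Lg ?addr0; last exact: bmfB.
apply: (@le_trans _ _ (C * e')).
  apply: Lb; first exact: bmfB.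
  by move=> x; have := fA x; rewrite indicT/= mulr1.
rewrite /e' mulrA ler_pdivrMr// mulrC ler_pM2l//.
by apply: le_trans (ler_norm _) _; rewrite lerDl.
Qed.

End bounded_functional.

(** Change of variables: [has_law] is the case of indicators, and [bmf_functional_eq0] does the
    rest. *)
Lemma Ex_has_law d1 d2 (T1 : measurableType d1) (T2 : measurableType d2) (R : realType)
    (P : probability T1 R) (mu : probability T2 R) (X : T1 -> T2) (f : T2 -> R) :
  measurable_fun setT X -> has_law P X mu -> bmf f ->
  Rintegral P setT (fun w => f (X w)) = Rintegral mu setT f.
Proof.
move=> mX lX bf; apply/eqP; rewrite -subr_eq0; apply/eqP.
pose L (f : T2 -> R) := Rintegral P setT (fun w => f (X w)) - Rintegral mu setT f.
rewrite -/(L f); apply: (@bmf_functional_eq0 _ _ _ L 2) => //.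
- move=> g h bg bh; rewrite /L !ExD//; first ring; exact: bmf_comp.
- move=> a g bg; rewrite /L !ExZ//; first ring; exact: bmf_comp.
- move=> g e bg ge; rewrite mulr_natl mulr2n; apply: le_trans (ler_normB _ _) _.
  by apply: lerD; apply: Ex_norm_le => //; exact: bmf_comp.
- move=> A mA; have mXA : measurable (X @^-1` A).
    by rewrite -[X in measurable X]setTI; exact: mX.
  rewrite /L (_ : Rintegral P _ _ = fine (P (X @^-1` A))); last exact: (Ex_indic P mXA).
  by rewrite lX// Ex_indic// subrr.
Qed.

(** * Product formulas and characteristic functions under independence *)

Section independence.
Context {d d' : measure_display} {O : measurableType d} {T : measurableType d'} {R : realType}.
Context {I : eqType} (P : probability O R) (X : I -> O -> T).
Hypothesis mX : forall c, measurable_fun setT (X c).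
Hypothesis indX : mutually_independent P X.
Local Notation Ex f := (Rintegral P setT f).

Lemma measurable_preimX c A : measurable A -> measurable (X c @^-1` A).
Proof. by move=> mA; rewrite -[X in measurable X]setTI; exact: mX. Qed.

Lemma indep_prod_indic (s : seq I) (A : I -> set T) : uniq s ->
  (forall c, measurable (A c)) ->
  Ex (fun w => \prod_(c <- s) \1_(A c) (X c w)) =
  \prod_(c <- s) Ex (fun w => \1_(A c) (X c w)).
Proof.
move=> us mA.
have indicE' c : (fun w => \1_(A c) (X c w) : R) = \1_(X c @^-1` A c).
  by apply/funext => w; rewrite !indicE; congr (_%:R); congr nat_of_bool;
    apply/idP/idP; rewrite !inE.
rewrite (_ : (fun w => _) = \1_(\bigcap_(i in [set i | i \in s]) (X i @^-1` A i))).
  rewrite Ex_indic; last first.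
    elim: s {us} => [|c s ih].
      by rewrite (_ : [set i | _] = set0) ?bigcap_set0//; apply/seteqP; split.
    rewrite (_ : [set i | _] = [set i | i \in s] `|` [set c]).
      by rewrite bigcap_setU bigcap_set1; apply: measurableI => //; exact: measurable_preimX.
    apply/seteqP; split => i /=; rewrite inE.
      by case/orP => [/eqP->|]; [right|left].
    by case=> [->|->]; rewrite ?eqxx ?orbT.
  rewrite indX//.
  transitivity (fine (\prod_(i <- s) (fine (P (X i @^-1` A i)))%:E)%E).
    congr fine; apply: eq_bigr => c _; rewrite fineK// fin_num_measure//.
    exact: measurable_preimX.
  rewrite prodEFin/=; apply: eq_bigr => c _.
  by rewrite indicE' Ex_indic//; exact: measurable_preimX.
apply/funext => w; rewrite indicE.
have [H|H] := pselect ((\bigcap_(i in [set i | i \in s]) (X i @^-1` A i)) w).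
  by rewrite (mem_set H) big_seq big1// => c cs; rewrite indicE mem_set//; exact: H.
rewrite (memNset H).
have [c cs nA] : exists2 c, c \in s & ~ A c (X c w).
  apply: contra_notP H => H c cs; apply: contrapT => nA; apply: H; exists c => //.
by rewrite (bigD1_seq c)//= indicE memNset ?mul0r.
Qed.

(** Indicators are replaced by bounded functions one variable at a time. As a functional of [f c],
    the difference of the two sides vanishes on indicators, by the induction hypothesis with c moved
    from [s1] to [s2]. *)
Lemma indep_prod_mixed (s1 s2 : seq I) (f : I -> T -> R) (A : I -> set T) :
  uniq (s1 ++ s2) -> (forall c, bmf (f c)) -> (forall c, measurable (A c)) ->
  Ex (fun w => \prod_(c <- s1) f c (X c w) * \prod_(c <- s2) \1_(A c) (X c w)) =
  \prod_(c <- s1) Ex (fun w => f c (X c w)) *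
  \prod_(c <- s2) Ex (fun w => \1_(A c) (X c w)).
Proof.
move=> us bf mA; elim: s1 s2 us A mA => [|c s1 ih] s2 us A mA.
  rewrite big_nil mul1r -indep_prod_indic//.
  by congr Rintegral; apply/funext => w; rewrite big_nil mul1r.
have /= /andP[cs us'] := us.
have bi (B : I -> set T) (mB : forall c, measurable (B c)) k : bmf (fun w => \1_(B k) (X k w) : R).
  by apply: bmf_comp => //; exact: bmf_indic.
pose rest w := \prod_(c <- s1) f c (X c w) * \prod_(c <- s2) \1_(A c) (X c w).
have brest : bmf rest.
  by apply: bmfM; apply: bmf_prod => k; [exact: bmf_comp|exact: bi].
pose L (g : T -> R) := Ex (fun w => g (X c w) * rest w) - Ex (fun w => g (X c w)) * Ex rest.
have [M' restM'] := brest.2; pose M := `|M'|.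
have restM w : `|rest w| <= M by apply: le_trans (restM' w) (ler_norm _).
have M0 : 0 <= M by exact: normr_ge0.
have bcM g : bmf g -> bmf (fun w => g (X c w) * rest w).
  by move=> bg; apply: bmfM => //; exact: bmf_comp.
have := @bmf_functional_eq0 _ _ _ L (2 * M) _ _ _ _ _ (bf c).
rewrite /L => L0.
rewrite big_cons -mulrA -(ih s2 us' A mA) -/rest; apply/eqP; rewrite -subr_eq0.
rewrite -[X in _ == X]L0; first by apply/eqP; congr (_ - _); congr Rintegral; apply/funext => w;
   rewrite big_cons mulrA.
- move=> g h bg bh; rewrite (_ : (fun w => _) = (fun w => g (X c w) * rest w + h (X c w) * rest w)).
    rewrite !ExD//; first (by ring); do ?exact: bcM; exact: bmf_comp.
  by apply/funext => w; rewrite mulrDl.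
- move=> a g bg; rewrite (_ : (fun w => _) = (fun w => a * (g (X c w) * rest w))).
    rewrite !ExZ//; first (by ring); do ?exact: bcM; exact: bmf_comp.
  by apply/funext => w; rewrite mulrA.
- move=> g e bg ge; rewrite -mulrA mulr_natl mulr2n; apply: le_trans (ler_normB _ _) _.
  rewrite normrM; apply: lerD.
    apply: Ex_norm_le; first exact: bcM.
    by move=> w; rewrite normrM mulrC ler_pM.
  by rewrite mulrC ler_pM// Ex_norm_le//; exact: bmf_comp.
- move=> B mB.
  (* Since c does not occur in [s2], putting B at c leaves the sets of the other indicators
     unchanged. *)
  pose A' k := if k == c then B else A k.
  have mA' k : measurable (A' k) by rewrite /A'; case: ifP.
  have us2 : uniq (s1 ++ c :: s2) by rewrite uniq_catC /= mem_cat orbC -mem_cat cs uniq_catC.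
  have A'c : A' c = B by rewrite /A' eqxx.
  have A's2 k : k \in s2 -> A' k = A k.
    rewrite /A'; case: eqP => // -> cs2.
    by move: cs; rewrite mem_cat cs2 orbT.
  have := ih _ us2 _ mA'; rewrite !big_cons A'c.
  rewrite (_ : (fun w => _) = (fun w => \1_B (X c w) * rest w)); last first.
    apply/funext => w; rewrite big_cons A'c mulrCA /rest; congr (_ * (_ * _)).
    by apply: eq_big_seq => k ks2; rewrite A's2.
  move=> ->; rewrite mulrCA /rest (ih s2 us' A mA); apply/eqP; rewrite subr_eq0; apply/eqP.
  congr (_ * (_ * _)); apply: eq_big_seq => k ks2; rewrite A's2//.
Qed.

Lemma indep_prod (s : seq I) (f : I -> T -> R) : uniq s -> (forall c, bmf (f c)) ->
  Ex (fun w => \prod_(c <- s) f c (X c w)) = \prod_(c <- s) Ex (fun w => f c (X c w)).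
Proof.
move=> us bf; have := @indep_prod_mixed s [::] f (fun=> setT).
rewrite cats0 big_nil mulr1 => <-//; congr Rintegral; apply/funext => w.
by rewrite big_nil mulr1.
Qed.

(* Linear combinations of products of functions of the single variables [X c]:
   independence of groups of variables is only ever needed for these, which
   avoids generated sigma-algebras. *)
Inductive prodspan (s : seq I) : (O -> R) -> Prop :=
| prodspan_prod f : (forall c, bmf (f c)) -> prodspan s (fun w => \prod_(c <- s) f c (X c w))
| prodspan_lin a U V : prodspan s U -> prodspan s V -> prodspan s (fun w => a * U w + V w).

Lemma prodspan_bmf s U : prodspan s U -> bmf U.
Proof.
elim=> [f bf|a U' V' _ bU _ bV]; first by apply: bmf_prod => c; exact: bmf_comp.
by apply: bmfD => //; exact: bmfZ.
Qed.

(** Both sides are bilinear in U and V, so single products suffice; as the lists are disjoint, two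
    such products merge into one over [s1 ++ s2]. *)
Lemma prodspan_indep s1 s2 U V : uniq (s1 ++ s2) -> prodspan s1 U -> prodspan s2 V ->
  Ex (fun w => U w * V w) = Ex U * Ex V.
Proof.
move=> us pU pV; have bV := prodspan_bmf pV.
elim: pU => [f bf|a U1 U2 pU1 ih1 pU2 ih2]; last first.
  have b1 := prodspan_bmf pU1; have b2 := prodspan_bmf pU2.
  rewrite (_ : (fun w => _) = (fun w => a * (U1 w * V w) + U2 w * V w)); last first.
    by apply/funext => w; ring.
  rewrite !ExD ?ExZ ?ih1 ?ih2//; first (by ring); do ?[exact: bmfM|exact: bmfZ|exact/bmfZ/bmfM].
have bF : bmf (fun w => \prod_(c <- s1) f c (X c w)) by apply: bmf_prod => c; exact: bmf_comp.
elim: pV {bV} => [g bg|a V1 V2 pV1 ih1 pV2 ih2]; last first.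
  have b1 := prodspan_bmf pV1; have b2 := prodspan_bmf pV2.
  rewrite (_ : (fun w => _) = (fun w => a * (\prod_(c <- s1) f c (X c w) * V1 w) +
     \prod_(c <- s1) f c (X c w) * V2 w)); last by apply/funext => w; ring.
  rewrite ExD ?ExZ ?ih1 ?ih2//; do ?[exact: bmfM|exact/bmfZ/bmfM].
  rewrite ExD ?ExZ//; first (by ring); exact: bmfZ.
pose k c := if c \in s1 then f c else g c.
have bk c : bmf (k c) by rewrite /k; case: ifP.
have k1 c : c \in s1 -> k c = f c by rewrite /k => ->.
have k2 c : c \in s2 -> k c = g c.
  move=> c2; rewrite /k ifF//; apply/negP => c1.
  by move: us; rewrite cat_uniq => /and3P[_ /hasPn/(_ _ c2)]; rewrite /= c1.
have := indep_prod us bk; rewrite big_cat/=.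
have [u1 u2] : uniq s1 /\ uniq s2 by move: us; rewrite cat_uniq => /and3P[].
rewrite (indep_prod u1)// (indep_prod u2)//.
under [X in _ = X * _ -> _]eq_big_seq do rewrite k1//.
under [X in _ = _ * X -> _]eq_big_seq do rewrite k2//.
move=> <-; congr Rintegral; apply/funext => w; rewrite big_cat/=.
by congr (_ * _); apply: eq_big_seq => c cs; [rewrite k1|rewrite k2].
Qed.

Lemma prodspan1 c (f : T -> R) : bmf f -> prodspan [:: c] (fun w => f (X c w)).
Proof.
move=> bf; rewrite (_ : (fun w => _) = (fun w => \prod_(k <- [:: c]) f (X k w))).
  by apply: (@prodspan_prod _ (fun=> f)).
by apply/funext => w; rewrite big_seq1.
Qed.

Lemma prodspan_cons c s f U : c \notin s -> bmf f -> prodspan s U ->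
  prodspan (c :: s) (fun w => f (X c w) * U w).
Proof.
move=> cs bf; elim=> [g bg|a U' V' _ pU _ pV].
  pose k i := if i == c then f else g i.
  rewrite (_ : (fun w => _) = (fun w => \prod_(i <- c :: s) k i (X i w))).
    by apply: prodspan_prod => i; rewrite /k; case: ifP.
  apply/funext => w; rewrite big_cons /k eqxx; congr (_ * _).
  by apply: eq_big_seq => i si; rewrite ifF//; apply/negbTE; apply: contraNneq cs => <-.
rewrite (_ : (fun w => _) = (fun w => a * (f (X c w) * U' w) + f (X c w) * V' w)).
  exact: prodspan_lin.
by apply/funext => w; ring.
Qed.

(** The addition formulas expand the cosine and sine of a sum into combinations of products of
    one-variable functions. *)
Lemma prodspan_trig s (g : I -> T -> R) : uniq s -> (forall c, measurable_fun setT (g c)) ->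
  prodspan s (fun w => cos (\sum_(c <- s) g c (X c w))) /\
  prodspan s (fun w => sin (\sum_(c <- s) g c (X c w))).
Proof.
move=> us mg; elim: s us => [_|c s ih /= /andP[cs us]].
  split.
    rewrite (_ : (fun w => _) = (fun w => \prod_(c <- [::] : seq I) (1 : R))).
      by apply: (@prodspan_prod [::] (fun=> fun=> 1)) => _; exact: bmf_cst.
    by apply/funext => w; rewrite !big_nil cos0.
  (* [prodspan_lin] only builds [a * U + V], so [sin 0] is written as -1 + 1. *)
  rewrite (_ : (fun w => _) =
      (fun w => (-1) * \prod_(c <- [::] : seq I) (1 : R) + \prod_(c <- [::] : seq I) (1 : R))).
    by apply: prodspan_lin; apply: (@prodspan_prod [::] (fun=> fun=> 1)) => _; exact: bmf_cst.
  by apply/funext => w; rewrite !big_nil sin0 mulr1 addNr.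
have [pc ps] := ih us.
have bc : bmf (fun x => cos (g c x)) by exact: bmf_cos.
have bs : bmf (fun x => sin (g c x)) by exact: bmf_sin.
split.
  rewrite (_ : (fun w => _) = (fun w => (-1) * (sin (g c (X c w)) * sin (\sum_(c <- s) g c (X c w)))
     + cos (g c (X c w)) * cos (\sum_(c <- s) g c (X c w)))).
    by apply: prodspan_lin; [exact: (prodspan_cons cs bs)|exact: (prodspan_cons cs bc)].
  by apply/funext => w; rewrite big_cons cosD; ring.
rewrite (_ : (fun w => _) = (fun w => 1 * (sin (g c (X c w)) * cos (\sum_(c <- s) g c (X c w)))
   + cos (g c (X c w)) * sin (\sum_(c <- s) g c (X c w)))).
  by apply: prodspan_lin; [exact: (prodspan_cons cs bs)|exact: (prodspan_cons cs bc)].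
by apply/funext => w; rewrite big_cons sinD mul1r.
Qed.

(** Together with [mean_sin_cons], the real and imaginary parts of the multiplicativity of
    characteristic functions. *)
Lemma mean_cos_cons c s (g : I -> T -> R) :
  uniq (c :: s) -> (forall c, measurable_fun setT (g c)) ->
  Ex (fun w => cos (\sum_(k <- c :: s) g k (X k w))) =
  Ex (fun w => cos (g c (X c w))) * Ex (fun w => cos (\sum_(k <- s) g k (X k w))) -
  Ex (fun w => sin (g c (X c w))) * Ex (fun w => sin (\sum_(k <- s) g k (X k w))).
Proof.
move=> us mg; have /= /andP[cs us'] := us; have [pc ps] := prodspan_trig us' mg.
have us1 : uniq ([:: c] ++ s) := us.
have bc : bmf (fun x => cos (g c x)) by exact: bmf_cos.
have bs : bmf (fun x => sin (g c x)) by exact: bmf_sin.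
rewrite -(prodspan_indep us1 (prodspan1 c bc) pc) -(prodspan_indep us1 (prodspan1 c bs) ps).
rewrite -ExB; [|exact: bmfM (prodspan_bmf (prodspan1 c bc)) (prodspan_bmf pc)
               |exact: bmfM (prodspan_bmf (prodspan1 c bs)) (prodspan_bmf ps)].
by congr Rintegral; apply/funext => w; rewrite big_cons cosD.
Qed.

Lemma mean_sin_cons c s (g : I -> T -> R) :
  uniq (c :: s) -> (forall c, measurable_fun setT (g c)) ->
  Ex (fun w => sin (\sum_(k <- c :: s) g k (X k w))) =
  Ex (fun w => sin (g c (X c w))) * Ex (fun w => cos (\sum_(k <- s) g k (X k w))) +
  Ex (fun w => cos (g c (X c w))) * Ex (fun w => sin (\sum_(k <- s) g k (X k w))).
Proof.
move=> us mg; have /= /andP[cs us'] := us; have [pc ps] := prodspan_trig us' mg.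
have us1 : uniq ([:: c] ++ s) := us.
have bc : bmf (fun x => cos (g c x)) by exact: bmf_cos.
have bs : bmf (fun x => sin (g c x)) by exact: bmf_sin.
rewrite -(prodspan_indep us1 (prodspan1 c bs) pc) -(prodspan_indep us1 (prodspan1 c bc) ps).
rewrite -ExD; [|exact: bmfM (prodspan_bmf (prodspan1 c bs)) (prodspan_bmf pc)
               |exact: bmfM (prodspan_bmf (prodspan1 c bc)) (prodspan_bmf ps)].
by congr Rintegral; apply/funext => w; rewrite big_cons sinD.
Qed.

(** Vanishing sine means say that each characteristic function is real; the cross terms of the
    recursion then disappear. *)
Lemma mean_trig_symmetric s (g : I -> T -> R) : uniq s -> (forall c, measurable_fun setT (g c)) ->
  (forall c, c \in s -> Ex (fun w => sin (g c (X c w))) = 0) ->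
  Ex (fun w => cos (\sum_(k <- s) g k (X k w))) = \prod_(k <- s) Ex (fun w => cos (g k (X k w))) /\
  Ex (fun w => sin (\sum_(k <- s) g k (X k w))) = 0.
Proof.
move=> us mg; elim: s us => [_ _|c s ih us s0].
  rewrite big_nil; split.
    by under eq_fun do rewrite big_nil cos0; exact: Ex_cst.
  by under eq_fun do rewrite big_nil sin0; exact: Ex_cst.
have [||ihc ihs] := ih; first by case/andP: us.
  by move=> k ks; apply: s0; rewrite inE ks orbT.
rewrite mean_cos_cons// mean_sin_cons// ihc ihs s0 ?mem_head// big_cons.
by rewrite !(mul0r, mulr0, subr0, addr0).
Qed.

End independence.

(** * Coordinates of a stable vector *)

Lemma measurable_coord (R : realType) (p : nat) (j : 'I_p) :
  measurable_fun setT (fun x : Rvec R p => (x : 'cV[R]_p) j 0).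
Proof.
move=> mD; apply: (measurability _ (RGenOpens.measurableE R)) => // _ [_ [a [b ->]] <-].
rewrite setTI; apply: sub_sigma_algebra; apply: open_comp; last exact: interval_open.
by move=> x _; exact: coord_continuous.
Qed.

Lemma stable_coord_law (R : realType) (p : nat) (alpha : R) (nu : probability (Rvec R p) R)
    (j : 'I_p) :
  stable_typeI alpha nu \/ stable_typeII alpha nu ->
  exists zeta : probability R R, SaS_law alpha zeta /\
    has_law nu (fun x : Rvec R p => (x : 'cV[R]_p) j 0) zeta.
Proof.
case=> -[zeta [sz nuE]]; exists zeta; split => // A mA.
  rewrite nuE; last by rewrite -[X in measurable X]setTI; exact: measurable_coord.
  by congr (zeta _); apply/funext => z; rewrite /preimage/= mxE.
(* Type II: a rectangle constrained only in direction j yields the marginal law. *)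
have := nuE (fun k => if k == j then A else setT).
rewrite (bigD1 j)//= eqxx big1 ?mule1; last first.
  by move=> k kj; rewrite (negbTE kj); exact: probability_setT.
move=> <-; last by move=> k; case: ifP.
congr (nu _); apply/seteqP; split => x /=; last by move/(_ j); rewrite eqxx.
by move=> xA k; case: eqP => [->|].
Qed.

(** This makes the three types indistinguishable from here on. Types I and II go through the
    coordinate law; type III is tested on the vector [w *: evec R j]. *)
Lemma stable_coord_trig (R : realType) (p : nat) (alpha : R) (nu : probability (Rvec R p) R) :
  stable_L1 alpha nu -> forall (j : 'I_p) (w : R),
  Rintegral nu setT (fun x : Rvec R p => cos (w * (x : 'cV[R]_p) j 0)) = expR (- `|w| `^ alpha)
  /\ Rintegral nu setT (fun x : Rvec R p => sin (w * (x : 'cV[R]_p) j 0)) = 0.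
Proof.
have mw (w : R) : measurable_fun setT (fun z : R => w * z) by exact: mulrl_measurable.
move=> nuL j w; have [nuI_II|nuIII] : (stable_typeI alpha nu \/ stable_typeII alpha nu) \/
   stable_typeIII alpha nu by case: nuL => [|[]]; tauto.
  have [zeta [sz lz]] := stable_coord_law j nuI_II; have [<- <-] := sz w.
  rewrite -(Ex_has_law (measurable_coord j) lz (bmf_cos (mw w))).
  by rewrite -(Ex_has_law (measurable_coord j) lz (bmf_sin (mw w))).
have dE (x : 'cV[R]_p) : dotv (w *: evec R j) x = w * x j 0.
  rewrite /dotv (bigD1 j)//= big1 ?addr0; first by rewrite !mxE !eqxx mulr1.
  by move=> k kj; rewrite !mxE (negbTE kj) mulr0 mul0r.
have nE : enorm (w *: evec R j) = `|w|.
  rewrite /enorm (bigD1 j)//= big1 ?addr0; first by rewrite !mxE !eqxx mulr1 sqrtr_sqr.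
  by move=> k kj; rewrite !mxE (negbTE kj) mulr0 expr0n.
have := nuIII (w *: evec R j); rewrite nE => -[<- <-].
by split; congr Rintegral; apply/funext => x; rewrite dE.
Qed.

(** * Cosine estimates and tail bounds from characteristic functions *)

Lemma one_minus_cos_le_sqr (R : realType) (x : R) : 1 - cos x <= x ^+ 2.
Proof.
have sin_le (y : R) : 0 <= y -> sin y <= y.
  move=> y0; have [|c _] := @MVT_segment R sin cos 0 y y0 (fun x _ => is_derive_sin x).
    by apply: continuous_subspaceT => z; exact: continuous_sin.
  by rewrite sin0 !subr0 => ->; rewrite ler_piMl// cos_le1.
rewrite -cos_norm -real_normK ?num_real//; move: (normr_ge0 x) => x0.
(* The increment of the cosine is [sin c * |x|] with [0 < c < |x|], and [sin c <= c]. *)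
have [|c cx] := @MVT_segment R cos (fun z => - sin z) 0 `|x| x0 (fun x _ => is_derive_cos x).
  by apply: continuous_subspaceT => z; exact: continuous_cos.
rewrite cos0 subr0 => cE; have {cE} -> : 1 - cos `|x| = sin c * `|x| by rewrite mulNr in cE; lra.
move: cx; rewrite in_itv/= => /andP[c0 cx].
by rewrite expr2 ler_wpM2r//; apply: le_trans cx; exact: sin_le.
Qed.

Lemma one_minus_cos1_gt0 (R : realType) : 0 < 1 - cos 1 :> R.
Proof.
have p2 := pi_ge2 R; have := @ltr_cos R 0 1; rewrite !in_itv/= cos0 subr_gt0 => ->//; lra.
Qed.

(** Cosine decreases on [0, pi], which contains [1, 2]. *)
Lemma one_minus_cos_ge (R : realType) (x : R) : 1 <= `|x| <= 2 -> 1 - cos 1 <= 1 - cos x.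
Proof.
move=> /andP[x1 x2]; rewrite lerD2l lerN2 -(cos_norm x).
have := @ltr_cos R 1 `|x|; rewrite !in_itv/= => H.
have p2 := pi_ge2 R.
have [->|] := eqVneq `|x| 1; first by [].
move=> xn1; apply: ltW; rewrite H ?lt_neqAle 1?eq_sym ?xn1//; lra.
Qed.

Section tails.
Context {d : measure_display} {O : measurableType d} {R : realType} (P : probability O R).
Local Notation Ex f := (Rintegral P setT f).

Lemma measurable_norm_ge (W : O -> R) (M : R) : measurable_fun setT W ->
  measurable [set w | M <= `|W w|].
Proof.
move=> mW; rewrite -[X in measurable X]setTI.
rewrite (_ : [set w | _] = (fun w => `|W w|) @^-1` `[M, +oo[%classic); last first.
  by apply/seteqP; split => x /=; rewrite in_itv/= andbT.
by apply: (measurableT_comp (@normr_measurable R setT) mW);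
  [exact: measurableT|exact: measurable_itv].
Qed.

(** The sets [|W| >= m] decrease to the empty set, so continuity from above applies. *)
Lemma tight_real (W : O -> R) (e : R) : measurable_fun setT W -> 0 < e ->
  exists M : nat, Ex (\1_[set w | M%:R <= `|W w|]) <= e.
Proof.
move=> mW e0; pose F (m : nat) := [set w | m%:R <= `|W w|].
have mF m : measurable (F m) by exact: measurable_norm_ge.
have F0 : \bigcap_m F m = set0.
  apply/seteqP; split => // w /= H; have := H (Num.truncn `|W w|).+1 I.
  by rewrite /F/= leNgt truncnS_gt.
have := @nonincreasing_cvg_mu _ _ _ P F _ mF _ _.
rewrite F0 measure0 => cF.
have {}cF : P (F m) @[m --> \oo] --> 0%E.
  apply: cF => //; first by rewrite (le_lt_trans (probability_le1 _ _)) ?ltry.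
  move=> m k mk; apply/subsetPset => w /=; apply: le_trans.
  by rewrite ler_nat.
have /fine_cvgP[_ /cvgr_lt/(_ e e0)[m _ Hm]] := cF.
exists m; rewrite (Ex_indic P (mF m)); apply: ltW; exact: (Hm m (leqnn m)).
Qed.

(* If [u |W| >= 1] then [u 2^-k |W|] lies in [1, 2] for some k, where [1 - cos] is
   at least [1 - cos 1]; dyadic frequencies thus control the whole tail. *)
Lemma indic_tail_dyadic (W : O -> R) (u : R) (m : nat) w : 0 < u ->
  \1_[set w | u^-1 <= `|W w|] w <=
  \sum_(k < m) (1 - cos 1)^-1 * (1 - cos (u * 2 ^- k * W w)) +
  \1_[set w | u^-1 * 2 ^+ m <= `|W w|] w :> R.
Proof.
move=> u0; have g0 := one_minus_cos1_gt0 R.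
elim: m => [|m ih]; first by rewrite big_ord0 add0r expr0 mulr1.
apply: le_trans ih _; rewrite big_ord_recr/= -addrA lerD2l.
rewrite !indicE; case: (boolP (w \in [set w | u^-1 * 2 ^+ m.+1 <= `|W w|])) => [_|].
  have : 0 <= (1 - cos 1)^-1 * (1 - cos (u * 2 ^- m * W w)).
    by rewrite mulr_ge0 ?invr_ge0 ?(ltW g0)// subr_ge0 cos_le1.
  by case: (_ \in _) => /=; lra.
rewrite notin_setE/= addr0 => /negP; rewrite -ltNge exprS => Wlt.
have [|_] := boolP (w \in _); last first.
  by rewrite mulr_ge0 ?invr_ge0 ?(ltW g0)// subr_ge0 cos_le1.
rewrite inE/= => Wge; rewrite mulrC ler_pdivlMr// mul1r; apply: one_minus_cos_ge.
have c0 : 0 < u * 2 ^- m by rewrite mulr_gt0// invr_gt0 exprn_gt0.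
have c1 : u * 2 ^- m * (u^-1 * 2 ^+ m) = 1.
  by field; rewrite gt_eqF//= expf_neq0.
rewrite normrM (gtr0_norm c0); apply/andP; split.
  by rewrite -[leLHS]c1 ler_pM2l.
have c2 : u * 2 ^- m * (u^-1 * (2 * 2 ^+ m)) = 2.
  by rewrite (mulrCA u^-1 2) (mulrCA (u / _) 2) c1 mulr1.
by rewrite -[leRHS]c2 ler_pM2l// ltW.
Qed.

(** In the dyadic bound the frequency [u * 2^-k] costs at most [c * u * 2^-k / (1 - cos 1)], a
    geometric series; the leftover tail is absorbed into e by tightness of W. *)
Lemma tail_of_cf (W : O -> R) (c u e : R) :
  measurable_fun setT W -> 0 <= c -> 0 < u <= 1 -> 0 < e ->
  (forall w, 0 < w <= 1 -> 1 - Ex (fun x => cos (w * W x)) <= c * w) ->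
  Ex (\1_[set w | u^-1 <= `|W w|]) <= 2 * c * u / (1 - cos 1) + e.
Proof.
move=> mW c0 /andP[u0 u1] e0 cfW; have g0 := one_minus_cos1_gt0 R.
have [m Hm] := tight_real mW e0.
have bc k : bmf (fun w => (1 - cos 1)^-1 * (1 - cos (u * 2 ^- k * W w))).
  apply/bmfZ/bmfB; first exact: bmf_cst.
  by apply: bmf_cos; apply: measurable_funM => //; exact: measurable_cst.
have bi M : bmf (\1_[set w | M <= `|W w|] : O -> R).
  by apply: bmf_indic; exact: measurable_norm_ge.
have := @Ex_le _ _ _ P _ _ (bi u^-1)
  (bmfD (bmf_sum (index_enum 'I_m) (fun k : 'I_m => bc k)) (bi (u^-1 * 2 ^+ m)))
  (fun w => indic_tail_dyadic W m w u0).
move/le_trans; apply; rewrite ExD//; last by apply: bmf_sum => k; exact: bc.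
rewrite Ex_sum//; apply: lerD; last first.
  apply: le_trans Hm; apply: Ex_le => //.
  move=> w; rewrite !indicE; have [|_] := boolP (w \in _); last by case: (_ \in _).
  rewrite inE/= => uW; rewrite mem_set//=; apply: le_trans uW.
  (* The m given by tightness serves as the number of scales, because [m <= 2^m <= u^-1 * 2^m] when
     [u <= 1]. *)
  apply: (@le_trans _ _ (2 ^+ m)); first by rewrite -natrX ler_nat ltnW// ltn_expl.
  by rewrite ler_peMl ?exprn_ge0// invf_ge1.
apply: (@le_trans _ _ (\sum_(k < m) c * u / (1 - cos 1) * 2 ^- k)).
  apply: ler_sum => k _; rewrite ExZ; last first.
    apply: bmfB; first exact: bmf_cst.
    by apply: bmf_cos; apply: measurable_funM => //; exact: measurable_cst.
  rewrite ExB ?Ex_cst; [|exact: bmf_cst|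
    by apply: bmf_cos; apply: measurable_funM => //; exact: measurable_cst].
  rewrite mulrC mulrAC ler_pM2r ?invr_gt0// -mulrA; apply: cfW.
  rewrite mulr_gt0//= ?invr_gt0 ?exprn_gt0// mulr_ile1 ?(ltW u0) ?invr_ge0 ?exprn_ge0//.
  by rewrite invf_le1 ?exprn_gt0// exprn_ege1// ler1n.
rewrite -mulr_sumr (_ : 2 * c * u / _ = c * u / (1 - cos 1) * 2); last by ring.
rewrite ler_wpM2l//; first by rewrite mulr_ge0 ?invr_ge0 ?(ltW g0)// mulr_ge0// ltW.
have -> : \sum_(k < m) 2 ^- k = 2 - 2 * 2 ^- m :> R.
  elim: m {Hm} => [|m ih]; first by rewrite big_ord0 expr0 invr1 mulr1 subrr.
  by rewrite big_ord_recr/= ih exprS invfM; field; rewrite expf_neq0.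
by rewrite lerBlDr lerDl mulr_ge0// invr_ge0 exprn_ge0.
Qed.

End tails.

Lemma powR_le1 (R : realType) (x r : R) : 0 <= x <= 1 -> 0 <= r -> x `^ r <= 1.
Proof.
move=> /andP[x0 x1] r0; have := @ge0_ler_powR R r r0 x 1; rewrite powR1; apply => //.
by rewrite nnegrE.
Qed.

(** * Variance of a sum of uncorrelated bounded variables *)

Section law_of_large_numbers.
Context {d : measure_display} {O : measurableType d} {R : realType} (P : probability O R).
Local Notation Ex f := (Rintegral P setT f).

(** Centred variables are bounded by 2, so each diagonal term is at most 4, and the off-diagonal
    terms have mean zero. *)
Lemma sum_sqr_uncorrelated (n : nat) (V : 'I_n -> O -> R) :
  (forall i, bmf (V i)) -> (forall i w, `|V i w| <= 1) ->
  (forall i k, i != k -> Ex (fun w => V i w * V k w) = Ex (V i) * Ex (V k)) ->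
  Ex (fun w => (\sum_(i < n) (V i w - Ex (V i))) ^+ 2) <= 4 * n%:R.
Proof.
move=> bV V1 uV; pose U i w := V i w - Ex (V i).
have bU i : bmf (U i) by apply: bmfB => //; exact: bmf_cst.
have U2 i w : `|U i w| <= 2.
  apply: le_trans (ler_normB _ _) _; rewrite (_ : 2 = 1 + 1 :> R)//.
  by apply: lerD => //; exact: Ex_norm_le.
have EU i : Ex (U i) = 0 by rewrite ExB ?Ex_cst ?subrr//; exact: bmf_cst.
rewrite (_ : (fun w => _) = (fun w => \sum_(i < n) \sum_(k < n) U i w * U k w)); last first.
  by apply/funext => w; rewrite expr2 big_distrlr.
rewrite Ex_sum; last by move=> i; apply: bmf_sum => k; exact: bmfM.
rewrite (_ : 4 * n%:R = \sum_(i < n) 4); last by rewrite sumr_const card_ord mulr_natr.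
apply: ler_sum => i _; rewrite Ex_sum; last by move=> k; exact: bmfM.
rewrite (bigD1 i)//= big1 ?addr0.
  apply: le_trans (ler_norm _) _; apply: Ex_norm_le; first exact: bmfM.
  by move=> w; rewrite normrM (_ : 4 = 2 * 2 :> R) ?ler_pM// -natrM.
move=> k ki; have bc (c : R) : bmf (fun _ : O => c) by exact: bmf_cst.
have -> : Ex (fun w => U i w * U k w) =
    Ex (fun w => V i w * V k w) - Ex (V k) * Ex (V i) - Ex (V i) * Ex (U k).
  rewrite -ExZ// -ExZ// -ExB; [|exact: bmfM|exact: bmfZ].
  rewrite -ExB; [|by apply: bmfB; [exact: bmfM|exact: bmfZ]|exact: bmfZ].
  by congr Rintegral; apply/funext => w; rewrite /U; ring.
by rewrite uV 1?eq_sym// EU mulr0 subr0 mulrC subrr.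
Qed.

End law_of_large_numbers.

(** * Particles without drift: characteristic function, tails, and the good event *)

Section stable_walk.
Context {d : measure_display} {O : measurableType d} {R : realType} {p n : nat}.
Variables (alpha : R) (nu : probability (Rvec R p) R) (P : probability O R).
Variables (theta0 : 'I_n -> O -> 'cV[R]_p) (Xi : 'I_n -> nat -> O -> 'cV[R]_p).
Hypothesis nuL : stable_L1 alpha nu.
Hypothesis mtheta : forall i, measurable_fun setT (theta0 i : O -> Rvec R p).
Hypothesis mXi : forall i k, measurable_fun setT (Xi i k : O -> Rvec R p).
Hypothesis lXi : forall i k, has_law P (Xi i k : O -> Rvec R p) nu.
Hypothesis indep : mutually_independent P
  (fun c : 'I_n + ('I_n * nat) =>
     match c with
     | inl i => (theta0 i : O -> Rvec R p)
     | inr ik => (Xi ik.1 ik.2 : O -> Rvec R p)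
     end).
Variables (K : nat) (a : R).
Local Notation Ex f := (Rintegral P setT f).

(** The scale [a] will be [sigma * eta^(1/alpha)], so [walk] is a coordinate of a particle with the
    gradient drift removed. *)
Definition noise i j w : R := a * \sum_(k < K) Xi i k w j 0.
Definition walk i j w : R := theta0 i w j 0 + noise i j w.

Let X (c : 'I_n + ('I_n * nat)) : O -> Rvec R p :=
  match c with
  | inl i => (theta0 i : O -> Rvec R p)
  | inr ik => (Xi ik.1 ik.2 : O -> Rvec R p)
  end.
(** The weights are chosen so that summing over [inl i :: steps i], the variables that drive
    particle i, gives [v * walk i j]. *)
Let g j (v : R) (c : 'I_n + ('I_n * nat)) (x : Rvec R p) : R :=
  (if c is inl _ then v else v * a) * (x : 'cV[R]_p) j 0.
Let steps i : seq ('I_n + ('I_n * nat)) := [seq inr (i, k) | k <- index_iota 0 K].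

Let mX c : measurable_fun setT (X c).
Proof. by case: c => [i|[i k]]; [exact: mtheta|exact: mXi]. Qed.

Let mg j v c : measurable_fun setT (g j v c).
Proof. by apply: measurable_funM; [exact: measurable_cst|exact: measurable_coord]. Qed.

Let steps_uniq i : uniq (inl i :: steps i).
Proof.
rewrite /= map_inj_uniq ?iota_uniq ?andbT; last by move=> k l [].
by apply/mapP => -[].
Qed.

Let steps_sum i j v w : \sum_(c <- steps i) g j v c (X c w) = v * noise i j w.
Proof.
rewrite big_map /noise -mulr_sumr mulrA; congr (_ * _).
by rewrite big_mkord.
Qed.

Let walk_sum i j v w : \sum_(c <- inl i :: steps i) g j v c (X c w) = v * walk i j w.
Proof. by rewrite big_cons steps_sum mulrDr. Qed.

Lemma measurable_noise i j : measurable_fun setT (noise i j).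
Proof.
apply: measurable_funM; first exact: measurable_cst.
apply: measurable_sum => k.
exact: (measurableT_comp (@measurable_coord R p j) (mXi i k)).
Qed.

Lemma measurable_walk i j : measurable_fun setT (walk i j).
Proof.
apply: measurable_funD; last exact: measurable_noise.
exact: (measurableT_comp (@measurable_coord R p j) (mtheta i)).
Qed.

Lemma noise_cf i j v :
  Ex (fun w => cos (v * noise i j w)) = expR (- (K%:R * `|v * a| `^ alpha)) /\
  Ex (fun w => sin (v * noise i j w)) = 0.
Proof.
have step k : Ex (fun w => cos (g j v (inr (i, k)) (X (inr (i, k)) w))) = expR (- `|v * a| `^ alpha)
   /\ Ex (fun w => sin (g j v (inr (i, k)) (X (inr (i, k)) w))) = 0.
  have [<- <-] := stable_coord_trig nuL j (v * a).
  have mm : measurable_fun setT (fun x : Rvec R p => v * a * (x : 'cV[R]_p) j 0).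
    by apply: measurable_funM; [exact: measurable_cst|exact: measurable_coord].
  by rewrite -(Ex_has_law (mXi i k) (lXi i k) (bmf_cos mm))
             -(Ex_has_law (mXi i k) (lXi i k) (bmf_sin mm)).
have us : uniq (steps i) by have /= /andP[] := steps_uniq i.
have [|] := mean_trig_symmetric mX indep us (mg j v).
  by move=> c /mapP[k _ ->]; exact: (step k).2.
under eq_fun do rewrite steps_sum; move=> ->.
under eq_fun do rewrite steps_sum; move=> ->; split => //.
rewrite big_map (eq_bigr (fun=> expR (- `|v * a| `^ alpha))).
  by rewrite prodr_const_nat subn0 -expRM_natl mulrN.
by move=> k _; exact: (step k).1.
Qed.

(** The initial value is independent of the noise and contributes a factor at most 1; its sine part
    is multiplied by the zero sine mean of the noise. *)
Lemma walk_cf_le i j v :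
  Ex (fun w => cos (v * walk i j w)) <= expR (- (K%:R * `|v * a| `^ alpha)).
Proof.
have := mean_cos_cons mX indep (steps_uniq i) (mg j v).
under eq_fun do rewrite walk_sum; move=> ->.
have cE : (fun w => cos (\sum_(k <- steps i) g j v k (X k w))) = (fun w => cos (v * noise i j w)).
  by apply/funext => w; rewrite steps_sum.
have sE : (fun w => sin (\sum_(k <- steps i) g j v k (X k w))) = (fun w => sin (v * noise i j w)).
  by apply/funext => w; rewrite steps_sum.
rewrite cE sE.
have [-> ->] := noise_cf i j v; rewrite mulr0 subr0 ler_piMl ?expR_ge0//.
apply: le_trans (ler_norm _) _; apply: Ex_norm_le; last by move=> w; exact: cos_max.
by apply: bmf_cos; exact: measurableT_comp (mg j v (inl i)) (mX (inl i)).
Qed.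

(** Distinct particles are driven by disjoint lists of variables, so [prodspan_indep] applies. *)
Lemma walk_uncorrelated i k j v : i != k ->
  Ex (fun w => cos (v * walk i j w) * cos (v * walk k j w)) =
  Ex (fun w => cos (v * walk i j w)) * Ex (fun w => cos (v * walk k j w)).
Proof.
move=> ik; have [ci _] := prodspan_trig X (steps_uniq i) (mg j v).
have [ck _] := prodspan_trig X (steps_uniq k) (mg j v).
have us : uniq ((inl i :: steps i) ++ (inl k :: steps k)).
  rewrite cat_uniq !steps_uniq andbT; apply/hasPn => c; rewrite !inE.
  apply: contraTN => /orP[/eqP->|/mapP[l _ ->]]; apply/norP; split.
  - by apply: contraNneq ik => -[->].
  - by apply/mapP => -[].
  - by [].
  - by apply: contraNN ik => /mapP[l' _ [-> _]].
have wE i' : (fun w => cos (\sum_(c <- inl i' :: steps i') g j v c (X c w))) =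
    (fun w => cos (v * walk i' j w)).
  by apply/funext => w; rewrite walk_sum.
by rewrite -!wE -(prodspan_indep mX indep us ci ck); congr Rintegral; apply/funext => w;
  rewrite !walk_sum.
Qed.

(** [tail_of_cf] asks for a bound linear in the frequency: [1 - exp (-x) <= x], and [v^alpha <= v]
    on (0, 1] because [alpha > 1]. *)
Lemma noise_tail i j (c u e : R) : 1 < alpha -> 0 <= a -> K%:R * a `^ alpha <= c ->
  0 < u <= 1 -> 0 < e ->
  Ex (\1_[set w | u^-1 <= `|noise i j w|]) <= 2 * c * u / (1 - cos 1) + e.
Proof.
move=> alpha1 a0 Kc u01 e0.
have c0 : 0 <= c by apply: le_trans Kc; rewrite mulr_ge0// powR_ge0.
apply: tail_of_cf => //; first exact: measurable_noise.
move=> v /andP[v0 v1]; have [-> _] := noise_cf i j v.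
rewrite ger0_norm ?mulr_ge0 ?(ltW v0)// powRM// ?(ltW v0)//.
apply: (@le_trans _ _ (K%:R * (v `^ alpha * a `^ alpha))).
  by rewrite lerBlDr -lerBlDl; apply: le_trans (expR_ge1Dx _); rewrite addrC; lra.
rewrite mulrCA mulrC; apply: ler_pM => //; rewrite ?powR_ge0 ?mulr_ge0 ?powR_ge0//.
rewrite -[leRHS]powRr1 ?(ltW v0)// (_ : alpha = 1 + (alpha - 1)); last by ring.
rewrite powRD; last by rewrite (gt_eqF v0) implybT.
by rewrite ler_piMr ?powR_ge0// powR_le1 ?(ltW v0)//; lra.
Qed.

(** The right-hand side is kept in the form [1 - q] that [good_event] expects. *)
Lemma walk_spread i j (c v : R) : 0 < v -> 0 <= a -> c <= K%:R * a `^ alpha ->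
  Ex (fun w => cos (v * walk i j w)) <= 1 - (1 - expR (- (c * v `^ alpha))).
Proof.
move=> v0 a0 cK; apply: le_trans (walk_cf_le i j v) _.
rewrite ger0_norm ?mulr_ge0 ?(ltW v0)// powRM// ?(ltW v0)// subKr ler_expR lerN2.
by rewrite [v `^ _ * _]mulrC mulrA ler_wpM2r// powR_ge0.
Qed.

Definition tame (M u : R) i w :=
  (\sum_(k < p) `|theta0 i w k 0| < M) && [forall k, `|noise i k w| < u^-1].

(** Markov bounds the number of columns that are not tame, Chebyshev the deviation of the sum of
    cosines; each failure costs eps / 2. *)
Lemma good_event (j : 'I_p) (kappa q e u M v eps : R) :
  (0 < n)%N -> 0 < kappa -> 0 < q ->
  (forall i, Ex (\1_[set w | M <= `|\sum_(k < p) `|theta0 i w k 0| |]) <= e) ->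
  (forall i k, Ex (\1_[set w | u^-1 <= `|noise i k w|]) <= 2 * e) ->
  (2 * p%:R + 1) * e <= eps * kappa / 2 ->
  (forall i, Ex (fun w => cos (v * walk i j w)) <= 1 - q) ->
  16 / (n%:R * q ^+ 2) <= eps / 2 ->
  exists A : set O, [/\ measurable A, ((1 - eps)%:E <= P A)%E &
    forall w, A w -> #|[pred i | ~~ tame M u i w]|%:R <= kappa * n%:R /\
      n%:R * q / 2 <= \sum_(i < n) (1 - cos (v * walk i j w))].
Proof.
move=> n0 kappa0 q0 thetaM noiseu epse walkq nq.
have n0' : 0 < n%:R :> R by rewrite ltr0n.
have mnorm i : measurable_fun setT (fun w => \sum_(k < p) `|theta0 i w k 0|).
  apply: measurable_sum => k; apply: (measurableT_comp (@normr_measurable R setT)).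
  exact: (measurableT_comp (@measurable_coord R p k) (mtheta i)).
(* A union bound in function form: [b i] is at least 1 wherever column i is not tame. *)
pose b i w : R := \1_[set w | M <= `|\sum_(k < p) `|theta0 i w k 0| |] w +
  \sum_(k < p) \1_[set w | u^-1 <= `|noise i k w|] w.
have bt i : bmf (\1_[set w | M <= `|\sum_(k < p) `|theta0 i w k 0| |] : O -> R).
  by apply: bmf_indic; exact: measurable_norm_ge.
have bn i k : bmf (\1_[set w | u^-1 <= `|noise i k w|] : O -> R).
  by apply: bmf_indic; apply: measurable_norm_ge; exact: measurable_noise.
have bb i : bmf (b i) by apply: bmfD => //; exact: bmf_sum.
have b0 i w : 0 <= b i w.
  by rewrite addr_ge0 ?sumr_ge0// => *; rewrite indicE.
have Eb i : Ex (b i) <= eps * kappa / 2.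
  apply: le_trans epse; rewrite ExD//; last exact: bmf_sum.
  rewrite addrC mulrDl mul1r lerD// Ex_sum//.
  apply: (@le_trans _ _ (\sum_(k < p) 2 * e)); first exact: ler_sum.
  by rewrite sumr_const card_ord -mulr_natr; rewrite le_eqVlt; apply/orP; left; apply/eqP; ring.
have b1 i w : ~~ tame M u i w -> 1 <= b i w.
  have i0 (A : set O) : 0 <= \1_A w :> R by rewrite indicE.
  rewrite negb_and -leNgt => /orP[Mt|/forallPn[k]].
    have H : \1_[set w | M <= `|\sum_(k < p) `|theta0 i w k 0| |] w = 1 :> R.
      by rewrite indicE mem_set//= ger0_norm// sumr_ge0.
    by rewrite /b H lerDl sumr_ge0.
  rewrite -leNgt => uk; have H : \1_[set w | u^-1 <= `|noise i k w|] w = 1 :> R.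
    by rewrite indicE mem_set.
  by rewrite /b (bigD1 k)//= addrCA H lerDl addr_ge0// sumr_ge0.
pose V i w : R := cos (v * walk i j w).
have mV i : measurable_fun setT (fun w => v * walk i j w).
  by apply: measurable_funM; [exact: measurable_cst|exact: measurable_walk].
have bV i : bmf (V i) by exact: bmf_cos.
pose Z w := (\sum_(i < n) (V i w - Ex (V i))) ^+ 2.
have EZ : Ex Z <= 4 * n%:R.
  apply: sum_sqr_uncorrelated => // [i w|i k ik]; first exact: cos_max.
  exact: walk_uncorrelated.
have bZ : bmf Z.
  rewrite /Z; under eq_fun do rewrite expr2.
  by apply: bmfM; apply: bmf_sum => i; apply: bmfB => //; exact: bmf_cst.
pose F w := \sum_(i < n) (1 - V i w).
have bF : bmf F by apply: bmf_sum => i; apply: bmfB => //; exact: bmf_cst.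
pose Sb w := \sum_(i < n) b i w.
have bSb : bmf Sb by exact: bmf_sum.
pose A := [set w | Sb w <= kappa * n%:R] `&` [set w | n%:R * q / 2 <= F w].
have mA : measurable A.
  apply: measurableI; rewrite -[X in measurable X]setTI.
    rewrite (_ : [set w | _] = Sb @^-1` `]-oo, (kappa * n%:R)]%classic).
      by apply: bSb.1 => //; exact: measurable_itv.
    by apply/seteqP; split => w /=; rewrite in_itv.
  rewrite (_ : [set w | _] = F @^-1` `[(n%:R * q / 2), +oo[%classic).
    by apply: bF.1 => //; exact: measurable_itv.
  by apply/seteqP; split => w /=; rewrite in_itv/= andbT.
exists A; split => //; last first.
  move=> w [/= Sw Fw]; split => //; apply: le_trans Sw.
  rewrite -sum1_card natr_sum /Sb [leRHS](bigID [pred i | ~~ tame M u i w])/=.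
  apply: ler_wpDr; first exact: sumr_ge0.
  by apply: ler_sum => i; rewrite inE; exact: b1.
have sumc (x : R) : n%:R * x = \sum_(i < n) x by rewrite sumr_const card_ord mulr_natl.
have kn0 : 0 < kappa * n%:R by rewrite mulr_gt0.
have nq0 : 0 < n%:R * q / 2 by rewrite divr_gt0 ?mulr_gt0.
(* Normalisations of Markov and Chebyshev: off A, [r1 * Sb] or [r2 * Z] is at least 1, so
   integrating the single inequality [bad] gives both bounds at once. *)
pose r1 := (kappa * n%:R)^-1; pose r2 := ((n%:R * q / 2) ^+ 2)^-1.
have r10 : 0 < r1 by rewrite invr_gt0.
have r20 : 0 < r2 by rewrite invr_gt0 exprn_gt0.
have bad w : 1 - (r1 * Sb w + r2 * Z w) <= \1_A w.
  have Sb0 : 0 <= Sb w by exact: sumr_ge0.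
  have Z0 : 0 <= Z w by exact: sqr_ge0.
  rewrite indicE; have [_|] := boolP (w \in A) => /=.
    by rewrite lerBlDr lerDl addr_ge0// mulr_ge0// ltW.
  rewrite notin_setE => nA; rewrite subr_le0.
  have [Sw|Sw] := leP (Sb w) (kappa * n%:R); last first.
    apply: (@le_trans _ _ (r1 * Sb w)); last by rewrite lerDl mulr_ge0// ltW.
    by rewrite /r1 mulrC ler_pdivlMr// mul1r ltW.
  have [Fw|Fw] := leP (n%:R * q / 2) (F w); first by case: nA.
  apply: (@le_trans _ _ (r2 * Z w)); last by rewrite lerDr mulr_ge0// ltW.
  rewrite /r2 mulrC ler_pdivlMr ?exprn_gt0// mul1r /Z -[leRHS]real_normK ?num_real//.
  rewrite ler_sqr ?nnegrE ?(ltW nq0)//; apply: le_trans (ler_norm _).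
  (* If [F < n q / 2] then the cosines sum to more than [n - n q / 2], while their means sum to at
     most [n - n q]; the deviation exceeds [n q / 2]. *)
  move: Fw; rewrite /F !sumrB sumr_const card_ord => Fw.
  have : \sum_(i < n) Ex (V i) <= n%:R * (1 - q).
    by rewrite sumc; apply: ler_sum => i _; exact: walkq.
  by move: Fw; set s1 := \sum_(i < n) V i w; set s2 := \sum_(i < n) _ => Fw s2n; lra.
have b12 : bmf (fun w => r1 * Sb w + r2 * Z w) by apply: bmfD; exact: bmfZ.
have := Ex_le P (bmfB (bmf_cst 1) b12) (bmf_indic mA) bad.
rewrite ExB ?Ex_cst; [|exact: bmf_cst|exact: b12].
rewrite ExD ?ExZ; do ?[exact: bSb|exact: bZ|exact: bmfZ].
rewrite Ex_indic// => EA; rewrite -(@fineK _ (P A)) ?fin_num_measure// lee_fin.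
apply: le_trans EA; rewrite lerD2l lerN2 (splitr eps); apply: lerD.
  rewrite Ex_sum//; apply: (@le_trans _ _ (r1 * (n%:R * (eps * kappa / 2)))).
    by rewrite ler_pM2l// sumc; exact: ler_sum.
  by rewrite /r1; rewrite le_eqVlt; apply/orP; left; apply/eqP; field; rewrite !gt_eqF.
apply: (@le_trans _ _ (r2 * (4 * n%:R))); first by rewrite ler_pM2l.
by apply: le_trans nq; rewrite /r2 le_eqVlt; apply/orP; left; apply/eqP;
  field; rewrite !gt_eqF.
Qed.

End stable_walk.

(** * Choice of the frequency, and deterministic bounds on columns and drift *)

Lemma small_frequency (R : realType) (alpha c L : R) : 0 < alpha < 2 -> 0 < c -> 0 <= L ->
  exists v : R, 0 < v /\ L * v ^+ 2 <= 1 - expR (- (c * v `^ alpha)).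
Proof.
move=> /andP[a0 a2] c0 L0; pose b := c / (1 + c).
have c1 : 0 < 1 + c by lra.
have b0 : 0 < b by rewrite divr_gt0.
pose dl := Num.min 1 (b / (L + 1)).
have L1 : 0 < L + 1 by lra.
have d0 : 0 < dl by rewrite lt_min ltr01 divr_gt0.
have d1 : dl <= 1 by rewrite ge_min lexx.
have dL : L * dl <= b.
  apply: (@le_trans _ _ (L * (b / (L + 1)))); first by rewrite ler_wpM2l// ge_min lexx orbT.
  by rewrite mulrA ler_pdivrMr// mulrC ler_pM2l// lerDl.
have a2' : 0 < 2 - alpha by lra.
(* With this v, [v^2 = v^alpha * dl], and [dl] is small enough that [L * dl <= b]: this is where
   [alpha < 2] enters. *)
pose v := dl `^ (2 - alpha)^-1.
have v0 : 0 < v by exact: powR_gt0.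
have va : v `^ (2 - alpha) = dl by rewrite /v -powRrM mulVf ?gt_eqF// powRr1// ltW.
have v2 : v ^+ 2 = v `^ alpha * dl.
  rewrite -powR_mulrn ?(ltW v0)// -va -powRD; first by congr (_ `^ _); ring.
  by rewrite (gt_eqF v0) implybT.
have v1 : v <= 1.
  by apply: powR_le1; rewrite ?invr_ge0 ?(ltW a2')// (ltW d0).
exists v; split => //; set y := v `^ alpha.
have y0 : 0 <= y by exact: powR_ge0.
have y1 : y <= 1.
  by apply: powR_le1; rewrite ?(ltW a0)// (ltW v0).
apply: (@le_trans _ _ (b * y)).
  by rewrite v2 mulrCA (mulrC b) ler_wpM2l.
have cy : 0 <= c * y by rewrite mulr_ge0// ltW.
(* From [exp x >= 1 + x]: the right-hand side is at least [c y / (1 + c y)], hence at least [b * y]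
   as [y <= 1]. *)
have E1 : expR (- (c * y)) <= (1 + c * y)^-1.
  by rewrite expRN lef_pV2 ?posrE ?expR_gt0 ?expR_ge1Dx//; lra.
apply: (@le_trans _ _ (1 - (1 + c * y)^-1)); last by rewrite lerD2l lerN2.
have -> : 1 - (1 + c * y)^-1 = c * y / (1 + c * y) by field; rewrite gt_eqF//; lra.
rewrite /b mulrAC ler_wpM2l// lef_pV2 ?posrE//; last lra.
by rewrite lerD2l ler_piMr// ltW.
Qed.

Lemma enorm_le_sum (R : realType) (p : nat) (v : 'cV[R]_p) : enorm v <= \sum_(j < p) `|v j 0|.
Proof.
have s0 : 0 <= \sum_(j < p) `|v j 0| by exact: sumr_ge0.
rewrite /enorm -[leRHS]ger0_norm// -sqrtr_sqr ler_sqrt ?sqr_ge0//.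
rewrite expr2 mulr_suml; apply: ler_sum => j _.
by rewrite -real_normK ?num_real// expr2 ler_wpM2l// (bigD1 j)//= lerDl sumr_ge0.
Qed.

(** A discarded column of norm above M would, with the m kept columns that dominate it, give m + 1
    columns above M. So the squared error is at most [n * M^2]. *)
Lemma top_cols_error (R : realType) (p n : nat) (Th : 'M[R]_(p, n)) (S : {set 'I_n})
    (m : nat) (M eps : R) :
  is_top_cols Th S m -> (#|[pred i | (M < enorm (col i Th))%R]| <= m)%N ->
  0 < eps -> n%:R * M ^+ 2 <= eps ^+ 2 * \sum_(j < p) \sum_(i < n) Th j i ^+ 2 ->
  frob (keep_cols Th S - Th) / frob Th <= eps.
Proof.
move=> [Sm top] cM e0 nM; have f0 : 0 <= frob Th by exact: sqrtr_ge0.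
have outside i : i \notin S -> enorm (col i Th) <= M.
  move=> iS; rewrite leNgt; apply/negP => Mi.
  suff : (m < #|[pred i | (M < enorm (col i Th))%R]|)%N by rewrite ltnNge cM.
  have <- : #|i |: S|%SET = m.+1 by rewrite cardsU1 iS Sm.
  apply: subset_leq_card; apply/fintype.subsetP => k; rewrite !inE => /orP[/eqP->//|kS].
  exact: lt_le_trans (top _ _ kS iS).
(* For a zero matrix the quotient is 0, since the inverse of 0 is 0. *)
have [F0|Fn0] := eqVneq (frob Th) 0; first by rewrite F0 invr0 mulr0 ltW.
rewrite ler_pdivrMr ?lt_neqAle 1?eq_sym ?Fn0//.
rewrite -(gtr0_norm e0) -sqrtr_sqr /frob -sqrtrM ?sqr_ge0// ler_sqrt; last first.
  by rewrite mulr_ge0 ?sqr_ge0// sumr_ge0// => j _; rewrite sumr_ge0// => i _; exact: sqr_ge0.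
apply: le_trans nM; rewrite exchange_big/= mulr_natl -[in leRHS](card_ord n) -sumr_const.
apply: ler_sum => i _.
have [iS|iS] := boolP (i \in S).
  by rewrite big1 ?sqr_ge0// => j _; rewrite !mxE iS subrr expr0n.
have -> : \sum_(j < p) (keep_cols Th S - Th) j i ^+ 2 = enorm (col i Th) ^+ 2.
  rewrite /enorm sqr_sqrtr; last by apply: sumr_ge0 => j _; exact: sqr_ge0.
  by apply: eq_bigr => j _; rewrite !mxE (negbTE iS) sub0r sqrrN.
by rewrite ler_sqr ?nnegrE ?outside// ?sqrtr_ge0// (le_trans _ (outside i iS))// sqrtr_ge0.
Qed.

(** The step factor [eta * n] cancels the 1/n of the gradient, so each step deviates from the
    driftless sum by at most [eta * C]. *)
Lemma sgd_traj_drift (R : realType) (dX dY : measure_display) (X : measurableType dX)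
    (Y : measurableType dY) (p l n : nat) (pi : probability (X * Y)%type R)
    (h : X -> 'cV[R]_p -> 'cV[R]_l) (ell : 'cV[R]_l -> Y -> R) (alpha sigma eta C : R)
    (Th0 : 'M[R]_(p, n)) (Xk : nat -> 'M[R]_(p, n)) (K : nat) :
  (0 < n)%N -> 0 <= eta ->
  (forall (Th : 'M[R]_(p, n)) j i, `|gradR pi h ell Th j i| <= n%:R^-1 * C) ->
  forall j i, `|sgd_traj pi h ell alpha sigma eta Th0 Xk K j i
    - (Th0 j i + sigma * eta `^ alpha^-1 * \sum_(k < K) Xk k j i)| <= K%:R * (eta * C).
Proof.
move=> n0 eta0 gC j i; elim: K => [|K ih].
  by rewrite big_ord0 mulr0 addr0 subrr normr0 mul0r.
rewrite /= big_ord_recr/= mxE mxE mxE mxE.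
set T := sgd_traj _ _ _ _ _ _ _ _ K in ih *; set G := gradR _ _ _ T j i.
rewrite [X in _ + X - _]mxE.
set a := sigma * _ in ih *; set S := \sum_(k < K) _ in ih *.
rewrite (_ : _ - _ = (T j i - (Th0 j i + a * S)) - eta * n%:R * G); last by ring.
apply: le_trans (ler_normB _ _) _; rewrite -natr1 mulrDl mul1r; apply: lerD => //.
rewrite normrM ger0_norm ?mulr_ge0// -mulrA ler_wpM2l//.
have n0' : 0 < n%:R :> R by rewrite ltr0n.
by rewrite mulrC -ler_pdivlMr// mulrC gC.
Qed.

(** * Choice of the constants and conclusion *)

Theorem theorem1
  (R : realType) (p l : nat) (alpha sigma : R)
  (dX dY : measure_display) (X : measurableType dX) (Y : measurableType dY)
  (pi : probability (X * Y)%type R)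
  (h : X -> 'cV[R]_p -> 'cV[R]_l) (ell : 'cV[R]_l -> Y -> R)
  (Psi : X -> R) (Phi : Y -> R) (B : R)
  (mu0 : probability (Rvec R p) R) (nu : probability (Rvec R p) R)
  (d : measure_display) (Omega : measurableType d) (P : probability Omega R)
  (theta0 : forall n : nat, 'I_n -> Omega -> 'cV[R]_p)
  (Xi : forall n : nat, 'I_n -> nat -> Omega -> 'cV[R]_p) :
  (* alpha in (1,2), sigma > 0 *)
  1 < alpha < 2 -> 0 < sigma ->
  (* Standing Assumption *)
  (forall x, twice_diff (h x)) ->
  (forall x th, `|h x th| + \sum_(j < p) `|'D_(evec R j) (h x) th|
        + \sum_(j < p) \sum_(k < p) `|'D_(evec R k) ('D_(evec R j) (h x)) th| <= Psi x) ->
  (forall y, twice_diff_real (ell^~ y)) ->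
  (forall a y, 0 <= ell a y) ->
  (forall a y, \sum_(j < l) `|'D_(evec R j) (ell^~ y) a|
        + \sum_(j < l) \sum_(k < l) `|'D_(evec R k) ('D_(evec R j) (ell^~ y)) a| <= Phi y) ->
  measurable_fun setT Psi -> measurable_fun setT Phi ->
  0 < B ->
  (\int[pi]_z ((Psi z.1) ^+ 2 * (1 + (Phi z.2) ^+ 2))%:E <= (B ^+ 2)%:E)%E ->
  (* the risk is well defined (finite) *)
  (forall (n : nat) (Th : 'M[R]_(p, n)),
     pi.-integrable setT (fun z => (ell (fnet h Th z.1) z.2)%:E)) ->
  (* initial law with finite first moment *)
  (\int[mu0]_x (enorm (x : 'cV[R]_p))%:E < +oo)%E ->
  (* law of L_1 of an alpha-stable Levy process of Type I, II or III *)
  stable_L1 alpha nu ->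
  (* random variables *)
  (forall n i, measurable_fun setT (theta0 n i : Omega -> Rvec R p)) ->
  (forall n i k, measurable_fun setT (Xi n i k : Omega -> Rvec R p)) ->
  (forall n i, has_law P (theta0 n i : Omega -> Rvec R p) mu0) ->
  (forall n i k, has_law P (Xi n i k : Omega -> Rvec R p) nu) ->
  (forall n, mutually_independent P
     (fun c : 'I_n + ('I_n * nat) =>
        match c with
        | inl i => (theta0 n i : Omega -> Rvec R p)
        | inr ik => (Xi n ik.1 ik.2 : Omega -> Rvec R p)
        end)) ->
  forall t kappa : R, 0 < t -> 0 < kappa < 1 ->
  exists eps0 : R, 0 < eps0 /\
  forall eps : R, 0 < eps < eps0 ->
  exists N : nat, forall (n : nat) (eta : R),
    (1 <= n)%N -> (N <= n)%N -> 0 < eta -> eta <= n%:R `^ (- (alpha / 2) - 1) ->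
    let Th (w : Omega) : 'M[R]_(p, n) :=
      sgd_traj pi h ell alpha sigma eta
        (\matrix_(j < p, i < n) theta0 n i w j 0)
        (fun k => \matrix_(j < p, i < n) Xi n i k w j 0)
        (Num.truncn (t / eta)) in
    exists A : set Omega, measurable A /\ ((1 - eps)%:E <= P A)%E /\
      A `<=` [set w | forall S : {set 'I_n},
                 is_top_cols (Th w) S (Num.truncn (kappa * n%:R)) ->
                 frob (keep_cols (Th w) S - Th w) / frob (Th w) <= eps].
Proof.
move=> /andP[a1 a2] s0 dh hPsi dell ell0 ellPhi mPsi mPhi B0 momB iell _ nuL mth mXi lth lXi ind.
move=> t kappa t0 /andP[k0 k1]; exists 1; split => // eps /andP[e0 e1].
have [p0|p0] := posnP p.
  exists 0%N => n eta _ _ _ _ Th; exists setT; split; first exact: measurableT.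
  split; first by rewrite probability_setT lee_fin gerBl ltW.
  move=> w _ S _; have -> : frob (Th w) = 0.
    by subst p; rewrite /frob big_ord0 sqrtr0.
  by rewrite invr0 mulr0 ltW.
pose j0 : 'I_p := Ordinal p0.
have sa0 : 0 < sigma `^ alpha by exact: powR_gt0.
(* [c1] will bound [K * a^alpha], and [C] the total drift, both because [K * eta <= t]. *)
pose c1 := sigma `^ alpha * t; have c10 : 0 < c1 by rewrite mulr_gt0.
pose C := t * (1 + B ^+ 2).
have C0 : 0 <= C by rewrite mulr_ge0 ?(ltW t0)// addr_ge0 ?sqr_ge0.
have g0 := one_minus_cos1_gt0 R.
have pp : 0 < 2 * p%:R + 1 :> R by rewrite ltr_wpDl ?mulr_ge0.
(* [e'] exhausts the Markov budget of [good_event], and u is small enough that [noise_tail] gives at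
   most [2 * e']. *)
pose e' := eps * kappa / 2 / (2 * p%:R + 1).
have e'0 : 0 < e' by rewrite !divr_gt0 ?mulr_gt0.
pose u := Num.min 1 (e' * (1 - cos 1) / (2 * c1)).
have u0 : 0 < u by rewrite lt_min ltr01/= divr_gt0 ?mulr_gt0.
have u1 : u <= 1 by rewrite ge_min lexx.
have ue : 2 * c1 * u / (1 - cos 1) <= e'.
  rewrite ler_pdivrMr// mulrC -ler_pdivlMr ?mulr_gt0//.
  by rewrite ge_min lexx orbT.
have mnorm : measurable_fun setT (fun x : Rvec R p => \sum_(k < p) `|(x : 'cV[R]_p) k 0|).
  apply: measurable_sum => k; apply: (measurableT_comp (@normr_measurable R setT)).
  exact: measurable_coord.
have [M0 HM0] := tight_real mu0 mnorm e'0.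
(* M bounds a tame column: its initial value, plus noise and drift in each of p coordinates. *)
pose M : R := M0%:R + p%:R * (u^-1 + C).
(* In L one factor 2 pays for separating the drift from the walk, the other for the [n q / 2] of
   [good_event]; [C^2] offsets the drift and [M^2 / eps^2] is the target. *)
pose L := 4 * (C ^+ 2 + M ^+ 2 / eps ^+ 2).
have L0 : 0 <= L by rewrite mulr_ge0// addr_ge0 ?sqr_ge0// divr_ge0 ?sqr_ge0.
have a02 : 0 < alpha < 2 by rewrite a2 andbT; lra.
have c20 : 0 < c1 / 2 by rewrite divr_gt0.
have [v [v0 Hv]] := small_frequency a02 c20 L0.
pose q := 1 - expR (- (c1 / 2 * v `^ alpha)).
have q0 : 0 < q by rewrite subr_gt0 expR_lt1 oppr_lt0 mulr_gt0// powR_gt0.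
(* The first term forces [eta <= 1 / n <= t / 2], the second makes the Chebyshev error at most eps /
   2. *)
exists (Num.truncn (2 / t + 32 / (eps * q ^+ 2))).+1 => n eta n1 nN eta0 etan Th.
have n0 : 0 < n%:R :> R by rewrite ltr0n.
have nR : 2 / t + 32 / (eps * q ^+ 2) < n%:R.
  by apply: lt_le_trans (truncnS_gt _) _; rewrite ler_nat.
have t20 : 0 < 2 / t by rewrite divr_gt0.
have eq0 : 0 < 32 / (eps * q ^+ 2) by rewrite divr_gt0// mulr_gt0 ?exprn_gt0.
have etat : eta <= t / 2.
  apply: le_trans etan _; apply: (@le_trans _ _ (n%:R `^ (-1))).
    by apply: ler_powR; [rewrite ler1n|lra].
  rewrite powR_inv1 ?(ltW n0)// -[t / 2]invrK invf_div lef_pV2 ?posrE//.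
  by apply: ltW; apply: le_lt_trans nR; rewrite lerDl ltW.
set K := Num.truncn (t / eta) in Th *.
have /andP[Kl Ku] := truncn_itv (divr_ge0 (ltW t0) (ltW eta0)).
have {}Kl : K%:R * eta <= t by rewrite -ler_pdivlMr.
(* Truncating [t / eta] loses less than one step, and [eta <= t / 2]. *)
have {}Ku : t / 2 <= K%:R * eta.
  move: Ku; rewrite ltr_pdivrMr// -/K -natr1 mulrDl mul1r => Ku; lra.
pose a := sigma * eta `^ alpha^-1.
have a0 : 0 <= a by rewrite mulr_ge0 ?powR_ge0// ltW.
(* Stable scaling: the noise depends on K and eta only through [K * eta], which lies in [t / 2, t],
   so all bounds are uniform in eta. *)
have Ka : K%:R * a `^ alpha = sigma `^ alpha * (K%:R * eta).
  rewrite /a powRM ?powR_ge0 ?(ltW s0)// -powRrM mulVf ?powRr1 ?(ltW eta0)//; first ring.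
  by rewrite gt_eqF//; lra.
have Kac1 : K%:R * a `^ alpha <= c1 by rewrite Ka ler_pM2l.
have Kac2 : c1 / 2 <= K%:R * a `^ alpha by rewrite Ka /c1 -mulrA ler_pM2l.
have [|||||A [mA PA HA]] := @good_event _ Omega R p n P (theta0 n) (Xi n)
  (mth n) (mXi n) (ind n) K a j0 kappa q e' u M0%:R v eps n1 k0 q0.
- move=> i; apply: le_trans HM0.
  have mF : measurable [set x : Rvec R p | M0%:R <= `|\sum_(k < p) `|(x : 'cV[R]_p) k 0| |].
    exact: measurable_norm_ge.
  rewrite -(Ex_has_law (mth n i) (lth n i) (bmf_indic mF)).
  exact: lexx.
- move=> i k; have u01 : 0 < u <= 1 by rewrite u0.
  apply: le_trans (noise_tail nuL (mth n) (mXi n) (lXi n) (ind n) i k a1 a0 Kac1 u01 e'0) _.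
  by rewrite [2 * e']mulr_natl mulr2n lerD2r.
- by rewrite mulrC divfK// gt_eqF.
- move=> i; exact: (walk_spread nuL (mth n) (mXi n) (lXi n) (ind n) i j0 v0 a0 Kac2).
- rewrite ler_pdivrMr; last by rewrite mulr_gt0 ?exprn_gt0.
  have : 32 / (eps * q ^+ 2) <= n%:R by apply: ltW; apply: le_lt_trans nR; rewrite lerDr ltW.
  rewrite ler_pdivrMr ?mulr_gt0 ?exprn_gt0// => H.
  by rewrite (_ : eps / 2 * _ = n%:R * (eps * q ^+ 2) / 2); [lra|ring].
exists A; split => //; split => // w Aw S topS.
have [card_bad spread] := HA w Aw.
have n0N : (0 < n)%N by [].
have drift j i : `|Th w j i - walk (theta0 n) (Xi n) K a i j w| <= C.
  have := @sgd_traj_drift R dX dY X Y p l n pi h ell alpha sigma eta (1 + B ^+ 2)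
    (\matrix_(j < p, i < n) theta0 n i w j 0) (fun k => \matrix_(j < p, i < n) Xi n i k w j 0) K
    n0N (ltW eta0) (gradR_bound dh hPsi dell ellPhi mPsi mPhi momB (iell n)) j i.
  rewrite mxE (eq_bigr (fun k : 'I_K => Xi n i k w j 0)); last by move=> k _; rewrite mxE.
  move/le_trans; apply; rewrite mulrA ler_wpM2r//.
  by rewrite addr_ge0 ?sqr_ge0.
apply: (@top_cols_error _ _ _ _ _ _ M _ topS _ e0).
(* A column of norm above M is not tame, so at most [kappa * n] exceed M; the count is an integer,
   so truncation keeps the bound. *)
- rewrite truncn_ge_nat; last by rewrite mulr_ge0 ?ltW.
  apply: le_trans card_bad; rewrite ler_nat; apply: subset_leq_card.
  apply/fintype.subsetP => i; rewrite !inE; apply: contraTN => /andP[thM /forallP nu_u].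
  rewrite -leNgt; apply: le_trans (enorm_le_sum _) _.
  apply: (@le_trans _ _ (\sum_(k < p) (`|theta0 n i w k 0| + (u^-1 + C)))).
    apply: ler_sum => k _; rewrite mxE.
    rewrite -[Th w k i](subrK (walk (theta0 n) (Xi n) K a i k w)) addrC.
    apply: le_trans (ler_normD _ _) _; rewrite addrA lerD ?drift//.
    apply: le_trans (ler_normD _ _) _; rewrite lerD2l; exact/ltW/nu_u.
  rewrite big_split/= sumr_const card_ord -[in leLHS]mulr_natl lerD2r; exact: ltW.
(* The single row [j0] already carries enough squared norm. *)
- rewrite (bigD1 j0)//= mulrDr; apply: ler_wpDr.
    rewrite mulr_ge0 ?sqr_ge0// sumr_ge0// => j _; rewrite sumr_ge0// => i _; exact: sqr_ge0.
  have sqr_walk i : (1 - cos (v * walk (theta0 n) (Xi n) K a i j0 w)) / (2 * v ^+ 2) - C ^+ 2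
      <= Th w j0 i ^+ 2.
    set x := walk _ _ _ _ _ _ _; set y := Th w j0 i.
    have xy : (y - x) ^+ 2 <= C ^+ 2.
      by rewrite -[leLHS]real_normK ?num_real// ler_sqr ?nnegrE// drift.
    have cx : (1 - cos (v * x)) / (2 * v ^+ 2) <= x ^+ 2 / 2.
      rewrite ler_pdivrMr ?mulr_gt0 ?exprn_gt0//.
      rewrite (_ : x ^+ 2 / 2 * _ = (v * x) ^+ 2); last by field.
      exact: one_minus_cos_le_sqr.
    (* Expanding this square gives [x^2 / 2 - (y - x)^2 <= y^2]. *)
    have := sqr_ge0 (2 * y - x); lra.
  have vq : L / 4 <= q / (4 * v ^+ 2).
    rewrite ler_pdivlMr ?mulr_gt0 ?exprn_gt0//; apply: le_trans Hv.
    by rewrite le_eqVlt; apply/orP; left; apply/eqP; field.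
  have H : n%:R * (M ^+ 2 / eps ^+ 2) <= \sum_(i < n) Th w j0 i ^+ 2.
    apply: (@le_trans _ _ (\sum_(i < n)
      ((1 - cos (v * walk (theta0 n) (Xi n) K a i j0 w)) / (2 * v ^+ 2)
       - C ^+ 2))); last exact: ler_sum.
    rewrite sumrB -mulr_suml sumr_const card_ord -(mulr_natl (C ^+ 2) n).
    apply: (@le_trans _ _ (n%:R * (L / 4) - n%:R * C ^+ 2)).
      by rewrite le_eqVlt; apply/orP; left; apply/eqP; rewrite /L; field; rewrite gt_eqF.
    rewrite lerD2r; apply: (@le_trans _ _ (n%:R * (q / (4 * v ^+ 2)))); first by rewrite ler_pM2l.
    rewrite ler_pdivlMr ?mulr_gt0 ?exprn_gt0//; apply: le_trans spread.
    by rewrite le_eqVlt; apply/orP; left; apply/eqP; field; rewrite gt_eqF.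
  rewrite -ler_pdivrMl ?exprn_gt0//; apply: le_trans H.
  by rewrite le_eqVlt; apply/orP; left; apply/eqP; ring.
Qed.
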